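(* Let $\Bbbk$ be a field with $\mathrm{char}(\Bbbk)\neq 2$, $n\ge 1$, let $A=Cl(\alpha,\beta_i,\gamma_i,\lambda_{ij})$ be a $2^{n+1}$-dimensional Clifford algebra with its canonical $E(n)$-comodule algebra structure, and consider the cowreath $(A\otimes E(n)^{\mathrm{op}},E(n),\psi)$. A $\Bbbk$-linear map $\mathfrak{T}:E(n)\to A\otimes E(n)^{\mathrm{op}}$ is an integral on the coalgebra $(E(n),\psi)$ if and only if the following three conditions hold. (1) $$\mathfrak{T}(g)=\sum_{j,P}\sum_{F\subseteq P}(-1)^{s(P\setminus F,P)+(j+|P|+1)|F|}\mu_{j,P}\,G^jX_{P\setminus F}\otimes g^{j+|P|+1}x_F$$ (outer sum over $j\in\{0,1\}$, $P\subseteq\{1,\dots,n\}$) with $\mu_{j,P}\in\Bbbk$ such that for every $P\subseteq\{1,\dots,n\}$ $$(1+(-1)^{|P|+1})\mu_{0,P}=\sum_{i\in P^c}(-1)^{s(P,P\sqcup\{i\})}\gamma_i\,\mu_{1,P\sqcup\{i\}},$$ $$(1+(-1)^{|P|+1})\mu_{1,P}\,\alpha=\sum_{i\in P^c}(-1)^{s(P,P\sqcup\{i\})}\gamma_i\,\mu_{0,P\sqcup\{i\}}.$$ (2) For every $P\subseteq\{1,\dots,n\}$ and every $r\in\{1,\dots,n\}$ such that $r>j$ for every $j\in P$, $$\begin{aligned}\mathfrak{T}(g^{|P|}x_Px_r)=\tfrac12\bigl[&(1_A\otimes g)\mathfrak{T}(g^{|P|+1}x_P)(X_r\otimes g)-(1_A\otimes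 gx_r)\mathfrak{T}(g^{|P|+1}x_P)(1_A\otimes g)\\&-\mathfrak{T}(g^{|P|+1}x_P)(1_A\otimes x_r)+(-1)^{|P|+1}(X_r\otimes 1_{E(n)})\mathfrak{T}(g^{|P|+1}x_P)\bigr].\end{aligned}$$ (3) For every $P\subseteq\{1,\dots,n\}$, $$\mathfrak{T}(g^{|P|}x_P)=\sum_{F\subsetneq P}(-1)^{s(F,P)+|P|+|F|+1}\mathfrak{T}(g^{|F|}x_F)(1_A\otimes x_{P\setminus F})+\mathfrak{U}_P,$$ where $$\mathfrak{U}_P=\sum_{k,Q}\sum_{F\subseteq Q}\eta(P;k,Q)(-1)^{s(Q\setminus F,Q)+(|P|+|Q|+k)|F|}G^kX_{Q\setminus F}\otimes g^{|P|+|Q|+k}x_F$$ (outer sum over $k\in\{0,1\}$, $Q\subseteq\{1,\dots,n\}$) and the scalars $\eta(P;k,Q)\in\Bbbk$ satisfy: (a) for every $Q\subseteq\{1,\dots,n\}$ and $k\in\{0,1\}$, $$[(-1)^{|P|}+(-1)^{|Q|+1}]\alpha^k\eta(P;k,Q)=\sum_{i\in Q^c}(-1)^{s(Q,Q\sqcup\{i\})}\gamma_i\,\eta(P;1-k,Q\sqcup\{i\});$$ and (b) for every $i\in\{1,\dots,n\}$ and every $Q\subseteq\{1,\dots,n\}$ with $i\notin Q$, the four equalities $$\begin{aligned}&[(-1)^{|P|+1}+(-1)^{|Q|+1}](-1)^{s(Q,Q\sqcup\{i\})}\eta(P;1,Q)\\&=\sum_{l\in Q^c,\,l<i}(-1)^{s(\{l\},Q\sqcup\{i,l\})+|P|+|Q|}\lambda_{li}\,\eta(P;1,Q\sqcup\{i,l\})+\sum_{l\in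 Q^c,\,l>i}(-1)^{s(\{l\},Q\sqcup\{i,l\})+1}\lambda_{li}\,\eta(P;1,Q\sqcup\{i,l\}),\end{aligned}$$ $$\begin{aligned}&[(-1)^{|P|}+(-1)^{|Q|}](-1)^{s(Q,Q\sqcup\{i\})}\beta_i\,\eta(P;1,Q\sqcup\{i\})\\&=\sum_{l\in Q^c,\,l<i}(-1)^{s(\{l\},Q\sqcup\{l\})+|P|+|Q|+1}\lambda_{li}\,\eta(P;1,Q\sqcup\{l\})+\sum_{l\in Q^c,\,l>i}(-1)^{s(\{l\},Q\sqcup\{l\})+1}\lambda_{li}\,\eta(P;1,Q\sqcup\{l\}),\end{aligned}$$ $$\begin{aligned}&[(-1)^{|P|+1}+(-1)^{|Q|}](-1)^{s(Q,Q\sqcup\{i\})}\eta(P;0,Q)+\gamma_i\,\eta(P;1,Q\sqcup\{i\})\\&=\sum_{l\in Q^c,\,l<i}(-1)^{s(\{l\},Q\sqcup\{i,l\})+1}\lambda_{li}\,\eta(P;0,Q\sqcup\{i,l\})+\sum_{l\in Q^c,\,l>i}(-1)^{s(\{l\},Q\sqcup\{i,l\})+|P|+|Q|+1}\lambda_{li}\,\eta(P;0,Q\sqcup\{i,l\}),\end{aligned}$$ $$\begin{aligned}&[(-1)^{|P|+1}+(-1)^{|Q|}](-1)^{s(Q,Q\sqcup\{i\})}\beta_i\,\eta(P;0,Q\sqcup\{i\})+\gamma_i\,\eta(P;1,Q)\\&=\sum_{l\in Q^c,\,l<i}(-1)^{s(\{l\},Q\sqcup\{l\})+1}\lambda_{li}\,\eta(P;0,Q\sqcup\{l\})+\sum_{l\in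 Q^c,\,l>i}(-1)^{s(\{l\},Q\sqcup\{l\})+|P|+|Q|}\lambda_{li}\,\eta(P;0,Q\sqcup\{l\}).\end{aligned}$$
   Context: Everything is over a field $\Bbbk$ with $\mathrm{char}(\Bbbk)\ne2$; $\otimes=\otimes_\Bbbk$; Sweedler notation with suppressed summation is used. $E(n)$ is the $2^{n+1}$-dimensional Hopf algebra generated by $g,x_1,\dots,x_n$ with $g^2=1$, $x_i^2=0$, $gx_i=-x_ig$, $x_ix_j=-x_jx_i$ ($i<j$), $\Delta(g)=g\otimes g$, $\varepsilon(g)=1$, $S(g)=g$, $\Delta(x_i)=x_i\otimes g+1\otimes x_i$, $\varepsilon(x_i)=0$, $S(x_i)=gx_i$. It has a bijective antipode. For $P=\{i_1<\dots<i_s\}\subseteq\{1,\dots,n\}$ put $x_P=x_{i_1}\cdots x_{i_s}$, $x_\emptyset=1$; the elements $g^jx_P$ ($j\in\{0,1\}$) form a basis. $Cl(\alpha,\beta_i,\gamma_i,\lambda_{ij})$, for fixed scalars $\alpha,\beta_i,\gamma_i$ ($1\le i\le n$), $\lambda_{ij}$ ($i<j$) in $\Bbbk$, is the unital associative algebra generated by $G,X_1,\dots,X_n$ with $G^2=\alpha$, $X_i^2=\beta_i$, $GX_i+X_iG=\gamma_i$, $X_iX_j+X_jX_i=\lambda_{ij}$ ($i<j$); it has basis $G^jX_P$ ($j\in\{0,1\}$, $P\subseteq\{1,\dots,n\}$), with $X_P=X_{i_1}\cdots X_{i_s}$. For $l>i$ set $\lambda_{li}:=\lambda_{il}$. Its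 canonical $E(n)$-comodule algebra structure is the algebra map $\rho$ with $\rho(G)=G\otimes g$, $\rho(X_i)=X_i\otimes g+1_A\otimes x_i$. Signs: for $P=\{i_1<\dots<i_s\}$ and $F=\{i_{j_1},\dots,i_{j_r}\}\subseteq P$, $s(F,P):=(j_1+\dots+j_r)-\frac{r(r+1)}2$, and $s(\emptyset,P):=0$. $P^c$ is the complement in $\{1,\dots,n\}$, $\sqcup$ is disjoint union. For a Hopf algebra $H$ and right $H$-comodule algebra $(A,\rho)$, $\rho(a)=a_0\otimes a_1$, the cowreath $(A\otimes H^{\mathrm{op}},H,\psi)$ has $\psi(h\otimes a\otimes l)=a_0\otimes l_1\otimes l_2ha_1$. Convention: products written without symbol in $A\otimes H$ use the ordinary multiplications of $A$ and $H$ (not the opposite one). An integral on $(H,\psi)$ is a $\Bbbk$-linear map $\mathfrak{T}:H\to A\otimes H^{\mathrm{op}}$, $\mathfrak{T}(h)=\mathfrak{T}^A(h)\otimes\mathfrak{T}^H(h)$, such that for all $a\in A,h\in H$: $$\mathfrak{T}^A(h_2)_0\otimes \mathfrak{T}^H(h_2)_1\otimes \mathfrak{T}^H(h_2)_2h_1\mathfrak{T}^A(h_2)_1=\mathfrak{T}(h)\otimes 1_H,$$ $$(a_0\otimes 1_H)\mathfrak{T}(S^{-1}(a_2)ha_1)(1_A\otimes S^{-1}(a_3))=(1_A\otimes S^{-1}(a_1))\mathfrak{T}(h)(a_0\otimes 1_H).$$ *)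

(* Defs.v *)
From HB Require Import structures.
From mathcomp Require Import all_boot all_order all_algebra all_field.

Set Implicit Arguments.
Unset Strict Implicit.
Unset Printing Implicit Defensive.

Import GRing.Theory.
Local Open Scope ring_scope.

Reserved Notation "v \ox w" (at level 45, left associativity,
  format "v  \ox  w").

(* The tensor product of two finite-dimensional spaces, in coordinates with   *)
(* respect to the bases vbasis {:V} and vbasis {:W}.                          *)
Definition tens (K : fieldType) (V W : vectType K) :=
  'M[K]_(\dim {:V}, \dim {:W}).

HB.instance Definition _ (K : fieldType) (V W : vectType K) :=
  Vector.copy (tens V W) 'M[K]_(\dim {:V}, \dim {:W}).

Definition tensor (K : fieldType) (V W : vectType K) (v : V) (w : W) :
  tens V W :=
  \matrix_(i, j) (coord (vbasis {:V}) i v * coord (vbasis {:W}) j w).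

Notation "v \ox w" := (tensor v w) : ring_scope.

(* For bilinear f, tlift f is the linear map v \ox w |-> f v w (tlift_tensor) *)
(* and does not depend on the bases. It also renders Sweedler's notation:     *)
(* an expression f h_1 h_2 with suppressed sum is tlift f (comul h).          *)
Definition tlift (K : fieldType) (V W U : vectType K) (f : V -> W -> U)
    (t : tens V W) : U :=
  \sum_i \sum_j t i j *: f (vbasis {:V})`_i (vbasis {:W})`_j.

Section TensorTheory.
Variables (K : fieldType) (V W U : vectType K).

Lemma tensor_linearl (w : W) : linear (fun v : V => v \ox w).
Proof.
by move=> a u v; apply/matrixP=> i j; rewrite !mxE linearP /= mulrDl mulrA.
Qed.

Lemma tensor_linearr (v : V) : linear (fun w : W => v \ox w).
Proof.
move=> a u w; apply/matrixP=> i j.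
by rewrite !mxE linearP /= mulrDr !mulrA [_ * a]mulrC.
Qed.

Lemma tens_decomp (t : tens V W) :
  t = \sum_i \sum_j t i j *: ((vbasis {:V})`_i \ox (vbasis {:W})`_j).
Proof.
have fV := basis_free (vbasisP {:V}); have fW := basis_free (vbasisP {:W}).
apply/matrixP=> k l; rewrite summxE (bigD1 k) //= summxE (bigD1 l) //=.
rewrite !mxE !coord_free // !eqxx !mulr1 big1 ?addr0 => [|j jl]; last first.
  by rewrite !mxE !coord_free // (negPf jl) !mulr0.
rewrite big1 ?addr0 // => i ik; rewrite summxE big1 // => j _.
by rewrite !mxE !coord_free // (negPf ik) mul0r mulr0.
Qed.

Lemma tlift_linear (f : V -> W -> U) : linear (tlift f).
Proof.
move=> a s t; rewrite /tlift scaler_sumr -big_split; apply: eq_bigr => i _ /=.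
rewrite scaler_sumr -big_split; apply: eq_bigr => j _ /=.
by rewrite !mxE scalerDl scalerA.
Qed.

Lemma tlift_tensor (f : V -> W -> U) (v : V) (w : W) :
  (forall w', linear (f^~ w')) -> (forall v', linear (f v')) ->
  tlift f (v \ox w) = f v w.
Proof.
move=> fl fr.
pose Fl w' := GRing.isLinear.Build K V U _ (f^~ w') (fl w').
pose Fr v' := GRing.isLinear.Build K W U _ (f v') (fr v').
pose gl w' : {linear V -> U} := HB.pack (f^~ w') (Fl w').
pose gr v' : {linear W -> U} := HB.pack (f v') (Fr v').
rewrite [in RHS](coord_vbasis (memvf v)) -[RHS]/(gl w _) linear_sum /tlift.
apply: eq_bigr => i _; rewrite linearZ /= [in RHS](coord_vbasis (memvf w)).
rewrite -[f _ _]/(gr (vbasis {:V})`_i _) linear_sum scaler_sumr.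
by apply: eq_bigr => j _; rewrite linearZ /= mxE scalerA.
Qed.

End TensorTheory.

Section TensorAlgebra.
Variables (K : fieldType) (A B : falgType K).
Local Notation AB := (tens A B).
Implicit Types t u : AB.

Definition tens_mul t u : AB :=
  tlift (fun a b => tlift (fun c d => (a * c) \ox (b * d)) u) t.

Lemma tens_mul_linearl u : linear (tens_mul^~ u).
Proof. exact: tlift_linear. Qed.

Lemma tens_mul_linearr t : linear (tens_mul t).
Proof.
move=> k u v.
pose F (a : A) (b : B) w := tlift (fun c d => (a * c) \ox (b * d)) w.
rewrite -3![tens_mul t _]/(tlift (fun a b => F a b _) t) /tlift.
rewrite scaler_sumr -big_split; apply: eq_bigr => i _ /=.
rewrite scaler_sumr -big_split; apply: eq_bigr => j _ /=.
by rewrite [F _ _ _]tlift_linear scalerDr !scalerA mulrC.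
Qed.

Lemma tens_mul_tensor (a c : A) (b d : B) :
  tens_mul (a \ox b) (c \ox d) = (a * c) \ox (b * d).
Proof.
have F a' b' :
    tlift (fun x y => (a' * x) \ox (b' * y)) (c \ox d) = (a' * c) \ox (b' * d).
  apply: tlift_tensor => z k x y /=; first by rewrite mulrDr -scalerAr tensor_linearl.
  by rewrite mulrDr -scalerAr tensor_linearr.
rewrite /tens_mul tlift_tensor ?F // => z k x y /=; rewrite !F.
  by rewrite mulrDl -scalerAl tensor_linearl.
by rewrite mulrDl -scalerAl tensor_linearr.
Qed.

Lemma tens_ind (P : AB -> Prop) :
  (forall a s t, P s -> P t -> P (a *: s + t)) -> (forall a b, P (a \ox b)) ->
  forall t, P t.
Proof.
move=> PD PT t.
have P0 : P 0 by rewrite -(addNr (0 \ox 0 : AB)) -scaleN1r; apply: PD.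
have Psum (I : finType) (F : I -> AB) : (forall i, P (F i)) -> P (\sum_i F i).
  move=> PF; elim/big_rec: _ => // i s _ Ps.
  by rewrite -[F i]scale1r; apply: PD.
rewrite [t]tens_decomp; apply: (Psum) => i; apply: Psum => j.
by rewrite -[_ *: _]addr0; apply: PD.
Qed.

Fact tens_mulA : associative tens_mul.
Proof.
move=> s t u.
elim/tens_ind: s => [a s s' IHs IHs'|a1 b1].
  by rewrite !tens_mul_linearl IHs IHs'.
elim/tens_ind: t => [a t t' IHt IHt'|a2 b2].
  by rewrite !(tens_mul_linearl, tens_mul_linearr) IHt IHt'.
elim/tens_ind: u => [a u u' IHu IHu'|a3 b3].
  by rewrite !tens_mul_linearr IHu IHu'.
by rewrite !tens_mul_tensor !mulrA.
Qed.

Fact tens_mul1t : left_id (1 \ox 1) tens_mul.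
Proof.
elim/tens_ind => [a t t' IHt IHt'|a b]; first by rewrite tens_mul_linearr IHt IHt'.
by rewrite tens_mul_tensor !mul1r.
Qed.

Fact tens_mult1 : right_id (1 \ox 1) tens_mul.
Proof.
elim/tens_ind => [a t t' IHt IHt'|a b]; first by rewrite tens_mul_linearl IHt IHt'.
by rewrite tens_mul_tensor !mulr1.
Qed.

Fact tens_mulDl : left_distributive tens_mul +%R.
Proof. by move=> s t u; have := tens_mul_linearl u 1 s t; rewrite !scale1r. Qed.

Fact tens_mulDr : right_distributive tens_mul +%R.
Proof. by move=> s t u; have := tens_mul_linearr s 1 t u; rewrite !scale1r. Qed.

Fact tens_1neq0 : 1 \ox 1 != 0 :> AB.
Proof.
apply/eqP=> E0.
have nz (D : falgType K) : exists i, coord (vbasis {:D}) i 1 != 0.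
  apply/existsP; apply: contraNT (oner_neq0 D); rewrite negb_exists => /forallP z.
  rewrite [1](coord_vbasis (memvf 1)) big1 // => i _.
  by have := z i; rewrite negbK => /eqP ->; rewrite scale0r.
have [i iP] := nz A; have [j jP] := nz B.
have /matrixP/(_ i j)/eqP := E0.
by rewrite !mxE mulf_eq0 (negPf iP) (negPf jP).
Qed.

HB.instance Definition _ := GRing.Zmodule_isNzRing.Build AB
  tens_mulA tens_mul1t tens_mult1 tens_mulDl tens_mulDr tens_1neq0.

Fact tens_scalerAl (k : K) t u : k *: (t * u) = k *: t * u.
Proof.
have t0u : tens_mul 0 u = 0 := mul0r u.
by have := tens_mul_linearl u k t 0; rewrite t0u !addr0.
Qed.

HB.instance Definition _ := GRing.Lmodule_isLalgebra.Build K AB tens_scalerAl.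

Fact tens_scalerAr (k : K) t u : k *: (t * u) = t * (k *: u).
Proof.
have tu0 : tens_mul t 0 = 0 := mulr0 t.
by have := tens_mul_linearr t k u 0; rewrite tu0 !addr0.
Qed.

HB.instance Definition _ := GRing.Lalgebra_isAlgebra.Build K AB tens_scalerAr.
HB.instance Definition _ := Algebra_isFalgebra.Build K AB.

Lemma tensorM (a c : A) (b d : B) :
  (a \ox b) * (c \ox d) = (a * c) \ox (b * d) :> AB.
Proof. exact: tens_mul_tensor. Qed.

End TensorAlgebra.

Record hopf_algebra (K : fieldType) := HopfAlgebra {
  hopf_alg :> falgType K;
  comul : {lrmorphism hopf_alg -> tens hopf_alg hopf_alg};
  counit : {lrmorphism hopf_alg -> K^o};
  antipode : 'End(hopf_alg);
  comulA : forall h : hopf_alg,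
    tlift (fun h1 h2 : hopf_alg =>
      tlift (fun u v : hopf_alg => (u \ox v) \ox h2) (comul h1)) (comul h)
    = tlift (fun h1 h2 : hopf_alg =>
        tlift (fun u v : hopf_alg => (h1 \ox u) \ox v) (comul h2)) (comul h);
  counitl : forall h : hopf_alg,
    tlift (fun h1 h2 : hopf_alg => counit h1 *: h2) (comul h) = h;
  counitr : forall h : hopf_alg,
    tlift (fun h1 h2 : hopf_alg => counit h2 *: h1) (comul h) = h;
  antipodel : forall h : hopf_alg,
    tlift (fun h1 h2 : hopf_alg => antipode h1 * h2) (comul h) = (counit h)%:A;
  antipoder : forall h : hopf_alg,
    tlift (fun h1 h2 : hopf_alg => h1 * antipode h2) (comul h) = (counit h)%:A
}.

Arguments comul {K h} : rename.
Arguments counit {K h} : rename.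
Arguments antipode {K h} : rename.

Record comodule_algebra (K : fieldType) (H : hopf_algebra K) := ComoduleAlgebra {
  comod_alg :> falgType K;
  coact : {lrmorphism comod_alg -> tens comod_alg H};
  coactA : forall a : comod_alg,
    tlift (fun (a0 : comod_alg) (a1 : H) =>
      tlift (fun (u : comod_alg) (v : H) => (u \ox v) \ox a1) (coact a0)) (coact a)
    = tlift (fun (a0 : comod_alg) (a1 : H) =>
        tlift (fun u v : H => (a0 \ox u) \ox v) (comul a1)) (coact a);
  coact_counit : forall a : comod_alg,
    tlift (fun (a0 : comod_alg) (a1 : H) => counit a1 *: a0) (coact a) = a
}.

Arguments coact {K H c} : rename.

(* (S^-1)%VF is the inverse of the antipode when the latter is bijective.     *)
Definition antipode_inv (K : fieldType) (H : hopf_algebra K) : 'End(H) :=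
  (antipode^-1)%VF.

Section Integral.
Variables (K : fieldType) (H : hopf_algebra K) (A : comodule_algebra H).
Local Notation Sinv := (@antipode_inv K H).

(* The space underlying A \otimes H^op is tens A H; all products, here and    *)
(* below, are those of A and H, not of H^op.                                  *)

(* psi (h \ox (a \ox l)) = a_0 \ox l_1 \ox l_2 h a_1                          *)
Definition cowreath_psi : tens H (tens A H) -> tens (tens A H) H :=
  tlift (fun (h : H) (t : tens A H) =>
    tlift (fun (a : A) (l : H) =>
      tlift (fun (a0 : A) (a1 : H) =>
        tlift (fun l1 l2 : H => (a0 \ox l1) \ox (l2 * h * a1)) (comul l))
      (coact a)) t).

Definition is_integral (T : {linear H -> tens A H}) : Prop :=
  (forall h : H,
     cowreath_psi (tlift (fun h1 h2 : H => h1 \ox T h2) (comul h)) = T h \ox 1) /\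
  (forall (a : A) (h : H),
     tlift (fun (a0 : A) (b : H) =>
       tlift (fun a1 c : H =>
         tlift (fun a2 a3 : H =>
           (a0 \ox 1) * T (Sinv a2 * h * a1) * (1 \ox Sinv a3)) (comul c))
       (comul b)) (coact a)
     = tlift (fun (a0 : A) (a1 : H) => (1 \ox Sinv a1) * T h * (a0 \ox 1)) (coact a)).

End Integral.

(* x_P, the factors being taken in increasing order of the indices.           *)
Definition xprod (n : nat) (R : pzRingType) (x : 'I_n -> R) (P : {set 'I_n}) : R :=
  \prod_(i <- enum P) x i.

(* s(F, P): the 1-based position in P of i \in P is #|[set l in P | l <= i]|, *)
(* and the truncated subtraction is exact for F \subset P.                    *)
Definition sexp (n : nat) (F P : {set 'I_n}) : nat :=
  ((\sum_(i in F) #|[set l in P | l <= i]|) - (#|F| * #|F|.+1) %/ 2)%N.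

Section Presentations.
Variables (K : fieldType) (n : nat).

(* A is the algebra presented by generators G, X_i and the relations rel, in  *)
(* the form of the universal property.                                        *)
Definition presented
    (rel : forall B : algType K, B -> ('I_n -> B) -> Prop)
    (A : algType K) (G : A) (X : 'I_n -> A) : Prop :=
  rel A G X /\
  forall (B : algType K) (G' : B) (X' : 'I_n -> B), rel B G' X' ->
    exists f : {lrmorphism A -> B},
      (f G = G' /\ forall i, f (X i) = X' i) /\
      forall f' : {lrmorphism A -> B},
        f' G = G' -> (forall i, f' (X i) = X' i) -> f' =1 f.

Definition monomial_basis (A : falgType K) (G : A) (X : 'I_n -> A) : bool :=
  basis_of {:A} [seq G ^+ p.1 * xprod X p.2 | p : bool * {set 'I_n}].

Definition En_rel (B : algType K) (g : B) (x : 'I_n -> B) : Prop :=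
  [/\ g ^+ 2 = 1,
      forall i, x i ^+ 2 = 0,
      forall i, g * x i = - (x i * g)
    & forall i j : 'I_n, (i < j)%N -> x i * x j = - (x j * x i)].

(* The basis fields of the two records below follow from the presentations    *)
(* and are part of the standing description of E(n) and Cl.                   *)
Record is_En (E : hopf_algebra K) (g : E) (x : 'I_n -> E) : Prop := IsEn {
  En_presented : presented En_rel g x;
  En_basis : monomial_basis g x;
  En_comulg : comul g = g \ox g;
  En_comulx : forall i, comul (x i) = x i \ox g + 1 \ox x i;
  En_counitg : counit g = 1;
  En_counitx : forall i, counit (x i) = 0;
  En_antipodeg : antipode g = g;
  En_antipodex : forall i, antipode (x i) = g * x i;
  En_antipode_bij : bijective (@antipode K E)
}.

Variables (alpha : K) (beta gamma : 'I_n -> K) (lambda : 'I_n -> 'I_n -> K).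

(* Only the values lambda i j with i < j are used.                            *)
Definition clifford_rel (B : algType K) (G : B) (X : 'I_n -> B) : Prop :=
  [/\ G ^+ 2 = alpha%:A,
      forall i, X i ^+ 2 = (beta i)%:A,
      forall i, G * X i + X i * G = (gamma i)%:A
    & forall i j : 'I_n, (i < j)%N -> X i * X j + X j * X i = (lambda i j)%:A].

Record is_clifford (A : falgType K) (G : A) (X : 'I_n -> A) : Prop := IsClifford {
  clifford_presented : presented clifford_rel G X;
  clifford_basis : monomial_basis G X
}.

Definition canonical_coaction (E : hopf_algebra K) (g : E) (x : 'I_n -> E)
    (A : comodule_algebra E) (G : A) (X : 'I_n -> A) : Prop :=
  coact G = G \ox g /\ forall i, coact (X i) = X i \ox g + 1 \ox x i.

(* lambda_{li} for l != i, with lambda_{li} := lambda_{il} when l > i.        *)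
Definition lam (l i : 'I_n) : K := if (l < i)%N then lambda l i else lambda i l.

End Presentations.

Section Conditions.
Variables (K : fieldType) (n : nat) (E : hopf_algebra K) (g : E) (x : 'I_n -> E).
Variables (alpha : K) (beta gamma : 'I_n -> K) (lambda : 'I_n -> 'I_n -> K).
Variables (A : comodule_algebra E) (G : A) (X : 'I_n -> A).
Variable T : {linear E -> tens A E}.

Local Notation "''x_' P" := (xprod x P) (at level 8, P at level 2).
Local Notation "''X_' P" := (xprod X P) (at level 8, P at level 2).
Local Notation s := (@sexp n).
Local Notation lam := (lam lambda).

(* Indices j, k in {0, 1} are booleans, so that 1 - k is ~~ k.                *)

Definition mu_conditions (mu : bool -> {set 'I_n} -> K) : Prop :=
  forall P : {set 'I_n},
    (1 + (-1) ^+ (#|P| + 1)) * mu false P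
      = \sum_(i in ~: P) (-1) ^+ s P (i |: P) * gamma i * mu true (i |: P)
    /\
    (1 + (-1) ^+ (#|P| + 1)) * mu true P * alpha
      = \sum_(i in ~: P) (-1) ^+ s P (i |: P) * gamma i * mu false (i |: P).

Definition condition1 : Prop :=
  exists mu : bool -> {set 'I_n} -> K,
    T g = \sum_(j : bool) \sum_(P : {set 'I_n}) \sum_(F : {set 'I_n} | F \subset P)
            ((-1) ^+ (s (P :\: F) P + (j + #|P| + 1) * #|F|) * mu j P) *:
              ((G ^+ j * 'X_(P :\: F)) \ox (g ^+ (j + #|P| + 1) * 'x_F))
    /\ mu_conditions mu.

Definition condition2 : Prop :=
  forall (P : {set 'I_n}) (r : 'I_n), (forall j, j \in P -> (j < r)%N) ->
    T (g ^+ #|P| * 'x_P * x r) =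
      2^-1 *: ((1 \ox g) * T (g ^+ (#|P| + 1) * 'x_P) * (X r \ox g)
               - (1 \ox (g * x r)) * T (g ^+ (#|P| + 1) * 'x_P) * (1 \ox g)
               - T (g ^+ (#|P| + 1) * 'x_P) * (1 \ox x r)
               + (-1) ^+ (#|P| + 1) *: ((X r \ox 1) * T (g ^+ (#|P| + 1) * 'x_P))).

(* In the conditions below, eta k Q stands for eta(P; k, Q).                  *)
Definition U_term (P : {set 'I_n}) (eta : bool -> {set 'I_n} -> K) : tens A E :=
  \sum_(k : bool) \sum_(Q : {set 'I_n}) \sum_(F : {set 'I_n} | F \subset Q)
    (eta k Q * (-1) ^+ (s (Q :\: F) Q + (#|P| + #|Q| + k) * #|F|)) *:
      ((G ^+ k * 'X_(Q :\: F)) \ox (g ^+ (#|P| + #|Q| + k) * 'x_F)).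

Definition eta_condition_a (P : {set 'I_n}) (eta : bool -> {set 'I_n} -> K) : Prop :=
  forall (Q : {set 'I_n}) (k : bool),
    ((-1) ^+ #|P| + (-1) ^+ (#|Q| + 1)) * alpha ^+ k * eta k Q
    = \sum_(i in ~: Q) (-1) ^+ s Q (i |: Q) * gamma i * eta (~~ k) (i |: Q).

Definition eta_condition_b1 (P Q : {set 'I_n}) (eta : bool -> {set 'I_n} -> K)
    (i : 'I_n) : Prop :=
  ((-1) ^+ (#|P| + 1) + (-1) ^+ (#|Q| + 1)) * (-1) ^+ s Q (i |: Q) * eta true Q
  = \sum_(l in ~: Q | (l < i)%N)
      (-1) ^+ (s [set l] (Q :|: [set i; l]) + #|P| + #|Q|)
        * lam l i * eta true (Q :|: [set i; l])
  + \sum_(l in ~: Q | (i < l)%N)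
      (-1) ^+ (s [set l] (Q :|: [set i; l]) + 1)
        * lam l i * eta true (Q :|: [set i; l]).

Definition eta_condition_b2 (P Q : {set 'I_n}) (eta : bool -> {set 'I_n} -> K)
    (i : 'I_n) : Prop :=
  ((-1) ^+ #|P| + (-1) ^+ #|Q|) * (-1) ^+ s Q (i |: Q)
    * beta i * eta true (i |: Q)
  = \sum_(l in ~: Q | (l < i)%N)
      (-1) ^+ (s [set l] (l |: Q) + #|P| + #|Q| + 1) * lam l i * eta true (l |: Q)
  + \sum_(l in ~: Q | (i < l)%N)
      (-1) ^+ (s [set l] (l |: Q) + 1) * lam l i * eta true (l |: Q).

Definition eta_condition_b3 (P Q : {set 'I_n}) (eta : bool -> {set 'I_n} -> K)
    (i : 'I_n) : Prop :=
  ((-1) ^+ (#|P| + 1) + (-1) ^+ #|Q|) * (-1) ^+ s Q (i |: Q) * eta false Q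
    + gamma i * eta true (i |: Q)
  = \sum_(l in ~: Q | (l < i)%N)
      (-1) ^+ (s [set l] (Q :|: [set i; l]) + 1)
        * lam l i * eta false (Q :|: [set i; l])
  + \sum_(l in ~: Q | (i < l)%N)
      (-1) ^+ (s [set l] (Q :|: [set i; l]) + #|P| + #|Q| + 1)
        * lam l i * eta false (Q :|: [set i; l]).

Definition eta_condition_b4 (P Q : {set 'I_n}) (eta : bool -> {set 'I_n} -> K)
    (i : 'I_n) : Prop :=
  ((-1) ^+ (#|P| + 1) + (-1) ^+ #|Q|) * (-1) ^+ s Q (i |: Q)
      * beta i * eta false (i |: Q)
    + gamma i * eta true Q
  = \sum_(l in ~: Q | (l < i)%N)
      (-1) ^+ (s [set l] (l |: Q) + 1) * lam l i * eta false (l |: Q)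
  + \sum_(l in ~: Q | (i < l)%N)
      (-1) ^+ (s [set l] (l |: Q) + #|P| + #|Q|) * lam l i * eta false (l |: Q).

Definition eta_conditions (P : {set 'I_n}) (eta : bool -> {set 'I_n} -> K) : Prop :=
  eta_condition_a P eta /\
  forall (i : 'I_n) (Q : {set 'I_n}), i \notin Q ->
    [/\ eta_condition_b1 P Q eta i, eta_condition_b2 P Q eta i,
        eta_condition_b3 P Q eta i & eta_condition_b4 P Q eta i].

Definition condition3 : Prop :=
  forall P : {set 'I_n}, exists eta : bool -> {set 'I_n} -> K,
    T (g ^+ #|P| * 'x_P) =
      \sum_(F : {set 'I_n} | F \proper P)
        (-1) ^+ (s F P + #|P| + #|F| + 1) *:
          (T (g ^+ #|F| * 'x_F) * (1 \ox 'x_(P :\: F)))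
      + U_term P eta
    /\ eta_conditions P eta.

End Conditions.

(* Main.v *)
(* For a in A put twist a = a_0 (x) S^-1(a_1), an injective map with left       *)
(* inverse id (x) counit, and for T : E(n) -> A (x) E(n) put                    *)
(* w(h) = T(h_2)(1 (x) h_1), from which T can be recovered. The first integral *)
(* axiom says psi(1 (x) w(h)) = w(h) (x) 1, that is, w(h) = twist (phi h) for  *)
(* some linear phi : E(n) -> A. The second axiom is multiplicative in a, so it *)
(* need only hold for a = G, X_i, where in terms of phi it reads               *)
(*   G phi(ghg) = phi(h) G,                                                    *)
(*   X_i phi(ghg) + phi(g h x_i) + phi(x_i g h) = phi(h) X_i.                  *)
(* E(n) is the direct sum of the left coideals spanned by the even elements    *)
(* g^|P| x_P and by the odd ones g^(|P|+1) x_P, and the axioms decouple.       *)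
(* On even h the middle terms cancel: phi(h) has to commute up to the sign     *)
(* (-1)^|P| with G and the X_i, which in coordinates is condition (3).         *)
(* On odd h they coincide: phi(g^|P| x_P x_r) is half a supercommutator of     *)
(* phi(h) with X_r, which is condition (2), so everything is determined by     *)
(* phi(g), which has to commute with G; this is condition (1). The remaining   *)
(* odd instances follow because the X_i anticommute up to scalars.             *)

Require Import Defs.
From HB Require Import structures.
From mathcomp Require Import all_boot all_order all_algebra all_field.
From mathcomp Require Import zify ring.
Set Implicit Arguments.
Unset Strict Implicit.
Unset Printing Implicit Defensive.
Import GRing.Theory.
Local Open Scope ring_scope.

(** * Tensor products *)

(** Convolution with h_1 on the right is invertible, with inverse built from S^-1 ([conv_along_inj],
    [rconv_inj]), so each axiom may be tested after convolving it. For the first axiom,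
    coassociativity carries h_1 through psi and leaves psi(1 (x) w(h)) = w(h) (x) 1. The counit on
    the middle leg shows that the solutions t of psi(1 (x) t) = t (x) 1 are exactly the elements a_0
    (x) S^-1(a_1) ([psi_at_twistP]), whence w = twist phi ([integral1P]). The second axiom reduces
    to generators of A ([integral2P]); after convolution its terms are expressed through w, and
    injectivity of twist leaves two equations in A ([integralG], [integralX]).

    On h = g^m x_P conjugation by g is the sign (-1)^|P|, and g h x_i and x_i g h differ by the sign
    (-1)^(m+1+|P|). If m and |P| have equal parity, the two middle terms cancel, and phi(h) commutes
    up to (-1)^|P| with G and the X_i; in the basis G^k X_Q these are the equations on eta
    ([comm_GP], [comm_XP], [condition3P]). Otherwise the middle terms agree and, 2 being invertible,
    determine phi on longer monomials by half supercommutators with X_r ([condition2P]); there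
    remains phi(g), which must commute with G ([condition1P]).

    Conversely, the odd equations must be recovered from those with r above P. [rconv_odd]
    propagates the form w = twist phi from g, [phi_odd] derives the equations for all r from a
    graded Jacobi identity ([half_supercomm_swap]), and [c_commG] treats G in the same way. *)

Section Tlift.
Variables (K : fieldType) (V W U U' : vectType K).
Implicit Types (f : V -> W -> U) (t : tens V W).

HB.instance Definition _ v :=
  GRing.isLinear.Build K W (tens V W) _ (tensor v) (tensor_linearr v).
HB.instance Definition _ f :=
  GRing.isLinear.Build K (tens V W) U _ (tlift f) (tlift_linear f).

Lemma tensorPl (w : W) k (u v : V) :
  (k *: u + v) \ox w = k *: (u \ox w) + v \ox w.
Proof. exact: tensor_linearl. Qed.

Lemma tensorDl (w : W) (u v : V) : (u + v) \ox w = u \ox w + v \ox w.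
Proof. by have := tensorPl w 1 u v; rewrite !scale1r. Qed.

Lemma tensor0l (w : W) : (0 : V) \ox w = 0.
Proof.
by have := tensorDl w 0 0; rewrite addr0 => /eqP; rewrite -subr_eq subrr eq_sym => /eqP.
Qed.

Lemma tensorZl (w : W) k (u : V) : (k *: u) \ox w = k *: (u \ox w).
Proof. by have := tensorPl w k u 0; rewrite tensor0l !addr0. Qed.

Lemma eq_tlift f f' t : (forall v w, f v w = f' v w) -> tlift f t = tlift f' t.
Proof. by move=> ff; apply: eq_bigr => i _; apply: eq_bigr => j _; rewrite ff. Qed.

Lemma tlift_lin f f1 f2 k t :
  (forall v w, f v w = k *: f1 v w + f2 v w) ->
  tlift f t = k *: tlift f1 t + tlift f2 t.
Proof.
move=> ff; rewrite /tlift scaler_sumr -big_split; apply: eq_bigr => i _ /=.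
rewrite scaler_sumr -big_split; apply: eq_bigr => j _ /=.
by rewrite ff scalerDr !scalerA mulrC.
Qed.

Lemma tliftD f f1 f2 t :
  (forall v w, f v w = f1 v w + f2 v w) -> tlift f t = tlift f1 t + tlift f2 t.
Proof.
by move=> ff; rewrite (@tlift_lin f f1 f2 1) ?scale1r // => v w; rewrite ff scale1r.
Qed.

Lemma tlift0 t : tlift (fun _ _ => 0 : U) t = 0.
Proof. by rewrite /tlift !big1 // => i _; rewrite big1 // => j _; rewrite scaler0. Qed.

Lemma linear_tlift (L : {linear U -> U'}) f t :
  L (tlift f t) = tlift (fun v w => L (f v w)) t.
Proof.
rewrite /tlift linear_sum; apply: eq_bigr => i _; rewrite linear_sum.
by apply: eq_bigr => j _; rewrite linearZ.
Qed.

Lemma tens_ext (L L' : {linear tens V W -> U}) :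
  (forall v w, L (v \ox w) = L' (v \ox w)) -> L =1 L'.
Proof.
move=> LL t; rewrite [t]tens_decomp !linear_sum; apply: eq_bigr => i _.
by rewrite !linear_sum; apply: eq_bigr => j _; rewrite !linearZ /= LL.
Qed.

End Tlift.

Definition bilin (K : fieldType) (V W U : vectType K) (f : V -> W -> U) :=
  (forall w, linear (f^~ w)) /\ (forall v, linear (f v)).

Lemma tlift_comp (K : fieldType) (V W V' W' U : vectType K)
    (h : V -> W -> tens V' W') (f : V' -> W' -> U) t :
  tlift f (tlift h t) = tlift (fun v w => tlift f (h v w)) t.
Proof. exact: (linear_tlift (tlift f)). Qed.

Lemma tliftT (K : fieldType) (V W U : vectType K) (f : V -> W -> U) v w :
  bilin f -> tlift f (v \ox w) = f v w.
Proof. by case=> fl fr; apply: tlift_tensor. Qed.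

Lemma tlift_tlift (K : fieldType) (V W V' W' U : vectType K)
    (f : V -> W -> V' -> W' -> U) (t : tens V W) (s : tens V' W') :
  tlift (fun v w => tlift (f v w) s) t =
  tlift (fun v' w' => tlift (fun v w => f v w v' w') t) s.
Proof.
rewrite /tlift; under eq_bigr do under eq_bigr do rewrite scaler_sumr.
under eq_bigr do rewrite exchange_big.
rewrite exchange_big; apply: eq_bigr => i _ /=.
under eq_bigr do under eq_bigr do rewrite scaler_sumr.
under eq_bigr do rewrite exchange_big.
rewrite exchange_big; apply: eq_bigr => j _ /=.
rewrite scaler_sumr; apply: eq_bigr => i' _; rewrite scaler_sumr.
by apply: eq_bigr => j' _; rewrite !scalerA mulrC.
Qed.

Section TliftAlg.
Variables (K : fieldType) (A B : falgType K) (U : vectType K) (f : A -> B -> U).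
Hypothesis fB : bilin f.

(** With [comul] and [coact] multiplicative, this turns a Sweedler sum over [comul (g * h)] or
    [coact (G * a)] into one over [comul h] or [coact a]. *)
Lemma tlift_mull u v (t : tens A B) :
  tlift f ((u \ox v) * t) = tlift (fun a b => f (u * a) (v * b)) t.
Proof.
have [fl fr] := fB.
elim/tens_ind: t => [k s t IHs IHt|a b].
  by rewrite mulrDr -scalerAr !linearP /= IHs IHt.
rewrite tensorM !tliftT //; split=> [w|w] k x y.
  by rewrite mulrDr -scalerAr fl.
by rewrite mulrDr -scalerAr fr.
Qed.

Lemma tlift_mulr u v (t : tens A B) :
  tlift f (t * (u \ox v)) = tlift (fun a b => f (a * u) (b * v)) t.
Proof.
have [fl fr] := fB.
elim/tens_ind: t => [k s t IHs IHt|a b].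
  by rewrite mulrDl -scalerAl !linearP /= IHs IHt.
rewrite tensorM !tliftT //; split=> [w|w] k x y.
  by rewrite mulrDl -scalerAl fl.
by rewrite mulrDl -scalerAl fr.
Qed.

End TliftAlg.

Section TliftPush.
Variables (K : fieldType) (V W U' : vectType K).

Lemma mul_tlift (A : falgType K) (c : A) (f : V -> W -> A) t :
  c * tlift f t = tlift (fun v w => c * f v w) t.
Proof. exact: (linear_tlift (GRing.mull_fun c idfun)). Qed.

Lemma tlift_mul (A : falgType K) (c : A) (f : V -> W -> A) t :
  tlift f t * c = tlift (fun v w => f v w * c) t.
Proof. exact: (linear_tlift (GRing.mulr_fun c idfun)). Qed.

Lemma tlift_tensl (U : vectType K) (c : U') (f : V -> W -> U) t :
  tlift f t \ox c = tlift (fun v w => f v w \ox c) t.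
Proof.
rewrite /tlift (big_morph (fun u => u \ox c) (tensorDl c) (tensor0l U c)).
apply: eq_bigr => i _.
rewrite (big_morph (fun u => u \ox c) (tensorDl c) (tensor0l U c)).
by apply: eq_bigr => j _; rewrite tensorZl.
Qed.

Lemma tlift_tensr (U : vectType K) (c : U') (f : V -> W -> U) t :
  c \ox tlift f t = tlift (fun v w => c \ox f v w) t.
Proof. exact: (linear_tlift (tensor c)). Qed.

End TliftPush.

Lemma mulPl (K : fieldType) (A : falgType K) k (u v w : A) :
  (k *: u + v) * w = k *: (u * w) + v * w.
Proof. by rewrite mulrDl -scalerAl. Qed.

Lemma mulPr (K : fieldType) (A : falgType K) k (u v w : A) :
  w * (k *: u + v) = k *: (w * u) + w * v.
Proof. by rewrite mulrDr -scalerAr. Qed.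

Lemma tlift_fun_linear (K : fieldType) (V W U U' : vectType K)
    (f : U' -> V -> W -> U) t :
  (forall v w, linear (fun c => f c v w)) -> linear (fun c => tlift (f c) t).
Proof. by move=> fl k u v; apply: tlift_lin => *; apply: fl. Qed.

Ltac lin := do ?(apply: tlift_fun_linear => ? ?); let k := fresh in
  let u := fresh in let v := fresh in move=> k u v /=;
  do ?first [rewrite mulPl | rewrite mulPr | rewrite tensorPl | rewrite linearP];
  try reflexivity.
Ltac bilt := let w := fresh in split=> w; lin.

(** * The antipode of E(n) *)

Section Coassoc.
Variables (K : fieldType) (E : hopf_algebra K) (U : vectType K).
Variable Phi : E -> E -> E -> U.
Hypothesis Phi1 : forall v w, linear (fun u => Phi u v w).
Hypothesis Phi2 : forall u w, linear (fun v => Phi u v w).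
Hypothesis Phi3 : forall u v, linear (fun w => Phi u v w).

(** A trilinear Phi factors through (E (x) E) (x) E; applying the resulting linear map to [comulA]
    gives coassociativity as it is used in Sweedler notation. *)
Lemma coassoc (h : E) :
  tlift (fun h1 h2 : E => tlift (fun u v => Phi u v h2) (comul h1)) (comul h) =
  tlift (fun h1 h2 : E => tlift (fun u v => Phi h1 u v) (comul h2)) (comul h).
Proof.
pose F (uv : tens E E) (w : E) := tlift (fun u v => Phi u v w) uv.
have FB : bilin F.
  split=> w k s t; first by rewrite /F linearP.
  by apply: tlift_lin => u v; rewrite Phi3.
have F3 u v w : tlift F ((u \ox v) \ox w) = Phi u v w.
  by rewrite tliftT // /F tliftT.
have /(congr1 (tlift F)) := comulA h; rewrite !tlift_comp => e.
transitivity (tlift (fun v w : E =>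
    tlift F (tlift (fun u v0 : E => (u \ox v0) \ox w) (comul v))) (comul h)).
  by apply: eq_tlift => u v; rewrite tlift_comp; apply: eq_tlift => ? ?; rewrite F3.
by rewrite e; apply: eq_tlift => u v; rewrite tlift_comp; apply: eq_tlift => ? ?; rewrite F3.
Qed.

End Coassoc.

Section Antipode.
Variables (K : fieldType) (E : hopf_algebra K).
Local Notation S := (@antipode K E).

(* Convolution with the identity is inverted by convolution with the antipode. *)
Lemma conv_antipodeK (f : {linear E -> E}) (h : E) :
  tlift (fun h1 h2 : E => tlift (fun u v => f u * v) (comul h1) * S h2) (comul h)
  = f h.
Proof.
pose Phi (u v w : E) := f u * (v * S w).
transitivity (tlift (fun h1 h2 : E =>
    tlift (fun u v => Phi u v h2) (comul h1)) (comul h)).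
  apply: eq_tlift => u v; rewrite tlift_mul.
  by apply: eq_tlift => ? ?; rewrite /Phi mulrA.
rewrite coassoc /Phi; do ?by move=> ? ?; lin.
transitivity (tlift (fun u v : E => f (counit v *: u)) (comul h)).
  apply: eq_tlift => u v; rewrite linearZ /= -[RHS]mulr_algr -antipoder.
  by rewrite mul_tlift.
by rewrite -linear_tlift counitr.
Qed.

(** [conv_antipodeK] recovers each map from its convolution with the identity. This is the
    uniqueness argument behind the formulas for S(gh) and S(x_i h). *)
Lemma conv_id_inj (f f' : {linear E -> E}) :
  (forall h : E, tlift (fun u v : E => f u * v) (comul h)
                 = tlift (fun u v : E => f' u * v) (comul h)) -> f =1 f'.
Proof.
move=> ff h; rewrite -[LHS]conv_antipodeK -[RHS]conv_antipodeK.
by apply: eq_tlift => u v; rewrite ff.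
Qed.

End Antipode.

Section CodomBasis.
Variables (K : fieldType) (V : vectType K) (I : finType) (e : I -> V).
Hypothesis eB : basis_of {:V} [seq e p | p : I].

Let b : #|I|.-tuple V := [tuple of [seq e p | p : I]].

Let nth_b p : b`_(enum_rank p) = e p.
Proof. by rewrite /b /= (nth_image _ e) enum_rankK. Qed.

Let sum_b (c : 'I_#|I| -> K) :
  \sum_p c (enum_rank p) *: e p = \sum_i c i *: b`_i.
Proof.
rewrite [RHS](reindex (@enum_rank I)) /=; last exact/onW_bij/enum_rank_bij.
by apply: eq_bigr => p _; rewrite nth_b.
Qed.

Lemma codom_basis_expand v : exists c, v = \sum_p c p *: e p.
Proof.
exists (fun p => coord b (enum_rank p) v); rewrite (sum_b (coord b ^~ v)).
exact: coord_basis (memvf v).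
Qed.

Lemma codom_basis_inj c d : \sum_p c p *: e p = \sum_p d p *: e p -> c =1 d.
Proof.
move=> cd p; have /freeP fb : free b := basis_free eB.
apply/eqP; rewrite -subr_eq0; apply/eqP.
pose f (i : 'I_#|I|) := c (enum_val i) - d (enum_val i).
have -> : c p - d p = f (enum_rank p) by rewrite /f enum_rankK.
apply: fb; rewrite -sum_b /f.
by under eq_bigr do rewrite enum_rankK scalerBl; rewrite sumrB cd subrr.
Qed.

End CodomBasis.

Section MonomialInd.
Variables (K : fieldType) (n : nat) (A : falgType K) (G : A) (X : 'I_n -> A).
Hypothesis mb : monomial_basis G X.

(** Basis monomials arise from 1 by left multiplications by the X_i and then by G. The principle
    serves both E(n) and A. *)
Lemma monomial_ind (Pr : A -> Prop) :
  (forall k a b, Pr a -> Pr b -> Pr (k *: a + b)) -> Pr 1 ->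
  (forall a, Pr a -> Pr (G * a)) -> (forall i a, Pr a -> Pr (X i * a)) ->
  forall a, Pr a.
Proof.
move=> PD P1 PG PX a.
have P0 : Pr 0 by rewrite -[0](addNr 1) -scaleN1r; apply: PD.
have [c ->] := codom_basis_expand mb a.
elim/big_rec: _ => // p s _ Ps; apply: PD => //.
have: Pr (xprod X p.2) by rewrite /xprod; elim: (enum _) => [|i q IH];
  rewrite ?big_nil // big_cons; apply: PX.
elim: (nat_of_bool p.1) => [|m IH] Px; first by rewrite mul1r.
by rewrite exprS -mulrA; apply/PG/IH.
Qed.

End MonomialInd.

Section En.
Variables (K : fieldType) (n : nat) (E : hopf_algebra K) (g : E) (x : 'I_n -> E).
Hypothesis EnE : is_En g x.
Local Notation S := (@antipode K E).
Local Notation Si := (@antipode_inv K E).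

Lemma En_gg : g * g = 1.
Proof. by have [[[gg _ _ _] _] _ _ _ _ _ _ _ _] := EnE; rewrite -expr2. Qed.
Lemma En_xx i : x i * x i = 0.
Proof. by have [[[_ xx _ _] _] _ _ _ _ _ _ _ _] := EnE; rewrite -expr2. Qed.
Lemma En_xg i : x i * g = - (g * x i).
Proof. by have [[[_ _ gx _] _] _ _ _ _ _ _ _ _] := EnE; rewrite gx opprK. Qed.
Lemma En_xC i j : x i * x j = - (x j * x i).
Proof.
have [[[_ xx gx xC] _] _ _ _ _ _ _ _ _] := EnE.
have [ij|ji|/val_inj ->] := ltngtP i j; first exact: xC.
  by rewrite (xC _ _ ji) opprK.
by rewrite En_xx oppr0.
Qed.

Lemma antipode1 : S 1 = 1.
Proof.
have := antipodel (1 : E); rewrite !rmorph1 tliftT; last by bilt.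
by rewrite mulr1 scale1r.
Qed.

(** As g is grouplike with counit 1, the antipode axiom at gh reads S(g h_1) g h_2 = eps(h): the map
    h -> S(gh) g is a left convolution inverse of the identity, like S. *)
Lemma antipode_gM h : S (g * h) = S h * g.
Proof.
pose f : {linear E -> E} := GRing.mulr_fun g (S \o GRing.mull_fun g idfun).
suff e: S (g * h) * g = S h by rewrite -e -mulrA En_gg mulr1.
rewrite -[LHS]/(f h); apply: conv_id_inj => {}h; rewrite antipodel.
have := antipodel (g * h); rewrite !rmorphM /= (En_comulg EnE) (En_counitg EnE) mul1r => <-.
rewrite tlift_mull; last by bilt.
by apply: eq_tlift => u v /=; rewrite mulrA.
Qed.

(** The antipode axiom at x_i h gives S(x_i h_1) g h_2 = - S(h_1) x_i h_2, so h -> S(x_i h) g and h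
    -> - S(h) x_i have the same convolution with the identity. *)
Lemma antipode_xM i h : S (x i * h) = S h * (g * x i).
Proof.
pose f : {linear E -> E} := GRing.mulr_fun g (S \o GRing.mull_fun (x i) idfun).
pose f' : {linear E -> E} := GRing.mulr_fun (- x i) S.
suff e: S (x i * h) * g = - (S h * x i).
  by rewrite -[LHS]mulr1 -En_gg mulrA e mulNr -mulrA En_xg mulrN opprK.
rewrite -mulrN -[LHS]/(f h) -[RHS]/(f' h); apply: conv_id_inj => {}h.
have := antipodel (x i * h).
rewrite !rmorphM /= (En_comulx EnE) (En_counitx EnE) mul0r scale0r.
rewrite mulrDl linearD /= !tlift_mull; try by bilt.
move=> /(canRL (addrK _)); rewrite sub0r => e.
transitivity (tlift (fun u v => S (x i * u) * (g * v)) (comul h)).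
  by apply: eq_tlift => u v /=; rewrite mulrA.
rewrite e -mulN1r mul_tlift; apply: eq_tlift => u v /=.
by rewrite mul1r mulN1r mulrN mulNr mulrA.
Qed.

Lemma antipodeM h k : S (h * k) = S k * S h.
Proof.
elim/(monomial_ind (En_basis EnE)): h k => [c a b IHa IHb k| k|a IH k|i a IH k].
- by rewrite mulPl !linearP /= IHa IHb mulPr.
- by rewrite antipode1 mul1r mulr1.
- by rewrite -mulrA !antipode_gM IH mulrA.
by rewrite -mulrA !antipode_xM IH mulrA.
Qed.

Lemma antipode_invK h : Si (S h) = h.
Proof. by apply: lker0_lfunK; apply/lker0P; exact: bij_inj (En_antipode_bij EnE). Qed.

Lemma antipodeK h : S (Si h) = h.
Proof.
have [S' SK S'K] := En_antipode_bij EnE.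
by rewrite -{1}[h]S'K antipode_invK S'K.
Qed.

Lemma antipode_invM h k : Si (h * k) = Si k * Si h.
Proof. by rewrite -{1}[h]antipodeK -{1}[k]antipodeK -antipodeM antipode_invK. Qed.

Lemma antipode_inv1 : Si 1 = 1.
Proof. by rewrite -{1}antipode1 antipode_invK. Qed.

Lemma antipode_invg : Si g = g.
Proof. by rewrite -{1}(En_antipodeg EnE) antipode_invK. Qed.

Lemma antipode_invx i : Si (x i) = x i * g.
Proof.
by rewrite -[RHS]antipode_invK antipode_xM (En_antipodeg EnE) mulrA En_gg mul1r.
Qed.

End En.

(** * Ordered monomials and signs *)

Section OrdSets.
Variable n : nat.
Implicit Types (P Q F D : {set 'I_n}) (i j l m r : 'I_n).

Definition above P r := forall j, j \in P -> (j < r)%N.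

Lemma above_notin P r : above P r -> r \notin P.
Proof. by move=> Pr; apply/negP=> /Pr; rewrite ltnn. Qed.

Lemma aboveS F P r : F \subset P -> above P r -> above F r.
Proof. by move=> /subsetP FP Pr j /FP /Pr. Qed.

(** A new largest index appends one factor at the right end of an ordered product ([xprodU1]); this
    is the induction for all monomial formulas below. *)
Lemma set_max_ind (Pr : {set 'I_n} -> Prop) :
  Pr set0 -> (forall P r, above P r -> Pr P -> Pr (r |: P)) -> forall P, Pr P.
Proof.
move=> P0 PU P; have [k] := ubnP #|P|; elim: k P => // k IH P.
have [->//|[i0 Pi0] Pk] := set_0Vmem P.
pose r := [arg max_(i > i0 in P) (i : nat)].
have [Pr0 rmax] : r \in P /\ forall j, j \in P -> (j <= r)%N.
  by rewrite /r; case: arg_maxnP => // i Pi imax; split=> // j /imax.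
rewrite -(setD1K Pr0); apply: PU.
  move=> j; rewrite !inE => /andP[jr /rmax]; rewrite leq_eqVlt => /orP[/eqP/val_inj e|//].
  by rewrite e eqxx in jr.
by apply: IH; move: Pk; rewrite (cardsD1 r P) Pr0; lia.
Qed.

Lemma sorted_enum P : sorted (fun i j => i < j)%N (enum P).
Proof.
rewrite {1}/enum_mem; apply: sorted_filter; first by move=> i j k; apply: ltn_trans.
rewrite -enumT.
by have := iota_ltn_sorted 0 n; rewrite -val_enum_ord sorted_map.
Qed.

Lemma enum_setU1 P r : above P r -> enum (r |: P) = rcons (enum P) r.
Proof.
move=> Pr; apply: (@irr_sorted_eq _ (fun i j => i < j)%N).
- by move=> i j k; apply: ltn_trans.
- by move=> i; rewrite /= ltnn.
- exact: sorted_enum.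
- rewrite sorted_pairwise; last by move=> i j k; apply: ltn_trans.
  rewrite pairwise_rcons -sorted_pairwise; last by move=> i j k; apply: ltn_trans.
  rewrite sorted_enum andbT; apply/allP=> j; rewrite mem_enum; exact: Pr.
by move=> j; rewrite mem_rcons inE !mem_enum !inE.
Qed.

Section Xprod.
Variables (R : pzRingType) (x : 'I_n -> R).

Lemma xprod0 : xprod x set0 = 1.
Proof. by rewrite /xprod enum_set0 big_nil. Qed.

Lemma xprodU1 P r : above P r -> xprod x (r |: P) = xprod x P * x r.
Proof. by move=> Pr; rewrite /xprod enum_setU1 // big_rcons. Qed.

Lemma xprodU P Q : (forall i j, i \in P -> j \in Q -> (i < j)%N) ->
  xprod x (P :|: Q) = xprod x P * xprod x Q.
Proof.
elim/set_max_ind: Q => [|Q r Qr IH] PQ; first by rewrite setU0 xprod0 mulr1.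
rewrite setUCA !xprodU1 ?IH ?mulrA //.
  by move=> i j iP jQ; apply: PQ; rewrite ?inE ?jQ ?orbT.
by move=> j /setUP[jP|/Qr//]; apply: PQ => //; rewrite setU11.
Qed.

Lemma xprod1 i : xprod x [set i] = x i.
Proof. by rewrite /xprod enum_set1 big_seq1. Qed.

End Xprod.

Definition ninv F D := (\sum_(i in F) #|[set l in D | (l < i)%N]|)%N.

(** Within F the ranks run through 1, ..., |F|; this is the number r(r+1)/2 subtracted in s(F,
    P). *)
Lemma sum_rank F : (\sum_(i in F) #|[set l in F | (l <= i)%N]|)%N = 'C(#|F|.+1, 2).
Proof.
elim/set_max_ind: F => [|F r Fr IH]; first by rewrite big_set0 cards0.
have rF := above_notin Fr; rewrite big_setU1 //= cardsU1 rF add1n binS bin1 addnC.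
congr (_ + _)%N.
  rewrite -IH; apply: eq_bigr => i iF; apply: eq_card => l; rewrite !inE.
  by case: eqP => [->|//]; rewrite leqNgt Fr // (negPf rF).
have -> : [set l in r |: F | (l <= r)%N] = r |: F.
  by apply/setP=> l; rewrite !inE; case: eqP => [->|] //=; case lF: (l \in F);
    rewrite ?leqnn //= ltnW ?Fr.
by rewrite cardsU1 rF.
Qed.

(* s(F, P) counts the inversions l < i with i \in F and l \in P \ F.             *)
Lemma sexpE F P : F \subset P -> sexp F P = ninv F (P :\: F).
Proof.
move=> FP; rewrite /sexp.
have -> : (\sum_(i in F) #|[set l in P | (l <= i)%N]| = ninv F (P :\: F) + 'C(#|F|.+1, 2))%N.
  rewrite -sum_rank -big_split; apply: eq_bigr => i iF /=.
  rewrite -(cardsID F) addnC; congr (_ + _)%N; apply: eq_card => l; rewrite !inE.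
    case lF: (l \in F) => //=; case lP: (l \in P) => //=.
    by rewrite ltn_neqAle; case: eqP => // /val_inj li; rewrite -li lF in iF.
  by case lF: (l \in F); rewrite ?andbF // andbT (subsetP FP).
by rewrite bin2 /= divn2 mulnC addnK.
Qed.

Lemma sexp_above F P r : F \subset P -> above P r -> sexp F (r |: P) = sexp F P.
Proof.
move=> FP Pr; rewrite !sexpE // ?subsetU ?FP ?orbT //.
apply: eq_bigr => i iF; apply: eq_card => l; rewrite !inE.
by case: eqP => [->|//]; rewrite ltnNge ltnW ?andbF // Pr // (subsetP FP).
Qed.

(** The new largest element of F makes an inversion with every element of P outside F and changes no
    other inversion. *)
Lemma sexpU1_above F P r : F \subset P -> above P r ->
  sexp (r |: F) (r |: P) = (sexp F P + #|P :\: F|)%N.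
Proof.
move=> FP Pr; have rP := above_notin Pr; have rF := above_notin (aboveS FP Pr).
rewrite !sexpE ?setUS // /ninv big_setU1 //= addnC.
have -> : (r |: P) :\: (r |: F) = P :\: F.
  by apply/setP=> l; rewrite !inE; case: eqP => [->|] //=; rewrite (negPf rP) andbF.
congr (_ + _)%N; apply: eq_card => l; rewrite !inE.
by case lP: (l \in P); rewrite ?andbF //= andbT Pr ?andbT.
Qed.

Lemma sexp1 l P : l \in P -> sexp [set l] P = #|[set m in P | (m < l)%N]|.
Proof.
move=> lP; rewrite sexpE ?sub1set // /ninv big_set1; apply: eq_card => m.
by rewrite !inE; case: eqP => [->|//]; rewrite ltnn !andbF.
Qed.

(** Only i lies outside P, so s(P, P + i) counts the factors that X_i passes on its way from the
    right end of X_P to its place. *)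
Lemma sexpC1 i P : i \notin P -> sexp P (i |: P) = #|[set m in P | (i < m)%N]|.
Proof.
move=> iP; rewrite sexpE ?subsetUr //; have -> : (i |: P) :\: P = [set i].
  by apply/setP=> l; rewrite !inE; case: eqP => [->|] //=; rewrite ?iP ?andNb.
rewrite /ninv -sum1dep_card big_mkcond [RHS]big_mkcond /=; apply: eq_bigr => m _.
case mP: (m \in P) => //=.
have -> : [set l in [set i] | (l < m)%N] = if (i < m)%N then [set i] else set0.
  by apply/setP=> l; rewrite !inE; case: eqP => [->|]; case: ifP;
    rewrite ?inE ?eqxx // => _ /eqP/negPf.
by case: ifP; rewrite ?cards1 ?cards0.
Qed.

Lemma card_lt_gt P i :
  (#|[set m in P | (m < i)%N]| + (i \in P) + #|[set m in P | (i < m)%N]|)%N = #|P|.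
Proof.
have -> : nat_of_bool (i \in P) = #|[set m in P | m == i]|.
  case iP: (i \in P); [rewrite -[LHS](cards1 i) | rewrite -[LHS](cards0 'I_n)];
    apply: eq_card => m;
    by rewrite !inE; case: eqP => [->|]; rewrite ?iP ?andbF.
rewrite -!sum1dep_card -[#|P|]sum1_card !(big_mkcond (fun m => (m \in P) && _)).
rewrite [RHS]big_mkcond -!big_split; apply: eq_bigr => m _ /=.
by case: (m \in P) => //=; rewrite -val_eqE; case: ltngtP.
Qed.

Lemma card_setDK F P : F \subset P -> (#|P :\: F| + #|F|)%N = #|P|.
Proof. by move=> FP; rewrite cardsD (setIidPr FP) subnK ?subset_leq_card. Qed.

Lemma setU1D P F r : r \notin F -> (r |: P) :\: F = r |: (P :\: F).
Proof. by move=> rF; apply/setP=> i; rewrite !inE; case: eqP => [->|//]; rewrite rF. Qed.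

Lemma setU1DU1 P F r : r \notin P -> (r |: P) :\: (r |: F) = P :\: F.
Proof.
by move=> rP; apply/setP=> i; rewrite !inE; case: eqP => [->|//] /=; rewrite (negPf rP) andbF.
Qed.

Lemma sexp0 P : sexp set0 P = 0%N.
Proof. by rewrite sexpE ?sub0set // /ninv big_set0. Qed.

Lemma sum_subsetU1 (V : nmodType) (f : {set 'I_n} -> V) P r : r \notin P ->
  \sum_(F : {set 'I_n} | F \subset r |: P) f F =
  \sum_(F : {set 'I_n} | F \subset P) f F
  + \sum_(F : {set 'I_n} | F \subset P) f (r |: F).
Proof.
move=> rP; rewrite (bigID (fun F => r \in F)) /= addrC; congr (_ + _).
  apply: eq_bigl => F; apply/andP/idP => [[/subsetP FP rF]|FP].
    by apply/subsetP=> i iF; have /setU1P[ir|//] := FP i iF; rewrite -ir iF in rF.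
  split; first by rewrite subsetU // FP orbT.
  by apply: contra rP; apply: (subsetP FP).
rewrite (reindex_onto (fun F => r |: F) (fun F => F :\ r)) /=; last first.
  by move=> F /andP[_ rF]; rewrite setD1K.
apply: eq_bigl => F; rewrite setU11 andbT; apply/andP/idP => [[FP /eqP <-]|FP].
  by rewrite subDset.
have rF : r \notin F by apply: contra rP; apply: (subsetP FP).
by rewrite setUS // setU1K.
Qed.

Lemma sum_in_setU1 (V : nmodType) (f : {set 'I_n} -> 'I_n -> V) :
  \sum_(Q : {set 'I_n}) \sum_(i in Q) f Q i
  = \sum_(Q : {set 'I_n}) \sum_(i in ~: Q) f (i |: Q) i.
Proof.
under eq_bigr do rewrite big_mkcond.
under [RHS]eq_bigr do rewrite big_mkcond.
rewrite exchange_big [RHS]exchange_big; apply: eq_bigr => i _ /=.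
rewrite -!big_mkcond (reindex_onto (fun Q => i |: Q) (fun Q => Q :\ i)) /=; last first.
  by move=> Q iQ; rewrite setD1K.
apply: eq_bigl => Q; rewrite setU11 inE /=; apply/eqP/idP => [<-|iQ].
  by rewrite !inE eqxx.
by rewrite setU1K.
Qed.

End OrdSets.

Lemma sign_eq (R : pzRingType) a b : odd a = odd b -> (-1) ^+ a = (-1) ^+ b :> R.
Proof. by move=> ab; rewrite -signr_odd ab signr_odd. Qed.

Ltac parity := rewrite ?(oddD, oddM, oddS) /=; do ?case: (odd _) => //=.

(** * Clifford algebras *)

Section Clifford.
Variables (K : fieldType) (n : nat) (A : falgType K).
Variables (alpha : K) (beta gamma : 'I_n -> K) (lambda : 'I_n -> 'I_n -> K).
Variables (G : A) (X : 'I_n -> A).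
Hypothesis rel : clifford_rel alpha beta gamma lambda G X.
Implicit Types (P Q R L H : {set 'I_n}) (i r l m : 'I_n) (k : bool).
Local Notation "''X_' P" := (xprod X P) (at level 8, P at level 2).
Local Notation lam := (lam lambda).
Local Notation lo Q l := #|[set m in Q | (m < l)%N]|.
Local Notation hi Q l := #|[set m in Q | (l < m)%N]|.

Lemma cl_GG : G * G = alpha%:A.
Proof. by case: rel => <-; rewrite expr2. Qed.
Lemma cl_XX i : X i * X i = (beta i)%:A.
Proof. by case: rel => _ <-; rewrite expr2. Qed.
Lemma cl_GX i : G * X i + X i * G = (gamma i)%:A.
Proof. by case: rel. Qed.
Lemma cl_XXl i l : l != i -> X i * X l + X l * X i = (lam l i)%:A.
Proof.
case: rel => _ _ _ XX; rewrite -val_eqE /lam /=; case: ltngtP => // li _.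
  by rewrite addrC XX.
by rewrite XX.
Qed.

Lemma hiU1 Q l : hi (l |: Q) l = hi Q l.
Proof.
by apply: eq_card => m; rewrite !inE; case: eqP => [->|//]; rewrite ltnn !andbF.
Qed.

Lemma loU1 Q l : lo (l |: Q) l = lo Q l.
Proof.
by apply: eq_card => m; rewrite !inE; case: eqP => [->|//]; rewrite ltnn !andbF.
Qed.

(** Moving u leftwards changes the sign at every factor; the exchange with X_l leaves kappa_l, after
    the factors of index above l have been passed. Used with u = G, and with u = X_i for Q on one
    side of i. *)
Lemma xprod_mulr (u : A) (kappa : 'I_n -> K) Q :
  (forall l, l \in Q -> u * X l + X l * u = (kappa l)%:A) ->
  'X_Q * u = (-1) ^+ #|Q| *: (u * 'X_Q)
             + \sum_(l in Q) ((-1) ^+ hi Q l * kappa l) *: 'X_(Q :\ l).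
Proof.
elim/set_max_ind: Q => [|Q r Qr IH] uX.
  by rewrite cards0 big_set0 xprod0 mulr1 mul1r scale1r addr0.
have rQ := above_notin Qr; rewrite big_setU1 //= hiU1.
have -> : hi Q r = 0%N.
  apply/eqP; rewrite cards_eq0 -subset0; apply/subsetP=> m; rewrite !inE.
  by case/andP=> /Qr; rewrite ltnNge leq_eqVlt => /norP[_ /negPf ->].
rewrite setU1K // expr0 mul1r xprodU1 // -mulrA.
have /(canRL (addKr _)) -> := uX r (setU11 _ _).
rewrite mulrDr mulrN -[_ * _%:A]scalerAr mulr1 mulrA IH => [|l lQ]; last first.
  by apply: uX; rewrite setU1r.
rewrite mulrDl opprD -addrA cardsU1 rQ exprS mulN1r scaleNr -scalerAl -[u * _ * _]mulrA.
congr (_ + _); rewrite addrC; congr (_ + _); rewrite mulr_suml -sumrN; apply: eq_bigr => l lQ.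
have Qlr : above (Q :\ l) r by apply: aboveS Qr; rewrite subsetDl.
have lr : r != l by apply: contraNneq rQ => ->.
have -> : (r |: Q) :\ l = r |: (Q :\ l).
  by apply/setP=> m; rewrite !inE; case: (m =P r) => // ->; rewrite lr.
have -> : hi (r |: Q) l = (hi Q l).+1.
  have -> : [set m in r |: Q | (l < m)%N] = r |: [set m in Q | (l < m)%N].
    by apply/setP=> m; rewrite !inE; case: eqP => //= ->; rewrite Qr.
  by rewrite cardsU1 inE (negPf rQ).
by rewrite xprodU1 // -scalerAl exprS mulN1r mulNr scaleNr.
Qed.

Lemma hi_lo Q l : l \in Q -> (lo Q l + hi Q l).+1 = #|Q|.
Proof. by move=> lQ; rewrite -(card_lt_gt Q l) lQ addn1 addSn. Qed.

Lemma xprod_mull (u : A) (kappa : 'I_n -> K) Q :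
  (forall l, l \in Q -> u * X l + X l * u = (kappa l)%:A) ->
  u * 'X_Q = (-1) ^+ #|Q| *: ('X_Q * u)
             + \sum_(l in Q) ((-1) ^+ lo Q l * kappa l) *: 'X_(Q :\ l).
Proof.
move/xprod_mulr ->; rewrite scalerDr scalerA -exprD addnn -signr_odd odd_double scale1r.
rewrite -addrA scaler_sumr -big_split big1 ?addr0 //= => l lQ.
rewrite scalerA -scalerDl mulrA -exprD -(hi_lo lQ) [_ ^+ (_ + _)](@sign_eq _ _ (lo Q l).+1).
  by rewrite exprS mulN1r mulNr addNr scale0r.
by parity.
Qed.

(** The symmetric difference of Q and {i}. Apart from a sign and the lambda terms, multiplication by
    X_i sends X_Q to this monomial, with factor beta_i when X_i^2 occurs ([toggle_coef]). *)
Definition toggle i Q := if i \in Q then Q :\ i else i |: Q.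
Definition toggle_coef i Q : K := if i \in Q then beta i else 1.

Lemma toggleK i : involutive (toggle i).
Proof.
move=> Q; rewrite /toggle; case iQ: (i \in Q); first by rewrite setD11 setD1K.
by rewrite setU11 setU1K ?iQ.
Qed.

(** X_i is inserted at its place in the ordered product. The two forms put it to the left or to the
    right of a factor X_i already present, according to the side from which it comes. *)
Lemma xprod_toggle i Q :
  'X_[set m in Q | (m < i)%N] * X i * 'X_[set m in Q | (i <= m)%N]
    = toggle_coef i Q *: 'X_(toggle i Q)
  /\ 'X_[set m in Q | (m <= i)%N] * X i * 'X_[set m in Q | (i < m)%N]
    = toggle_coef i Q *: 'X_(toggle i Q).
Proof.
have e1 : 'X_[set m in Q | (m < i)%N] * X i * 'X_[set m in Q | (i < m)%N]
    = 'X_(i |: Q).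
  rewrite -xprod1 -mulrA -!xprodU => [|j k|j k].
  - congr xprod; apply/setP=> m; rewrite !inE -val_eqE /=.
    by case: (m \in Q); rewrite ?orbT ?orbF //=; case: ltngtP.
  - by rewrite !inE => /andP[_ ji] /orP[/eqP->//|/andP[_]]; apply: ltn_trans.
  by rewrite !inE => /eqP -> /andP[].
case iQ: (i \in Q); rewrite /toggle /toggle_coef iQ; last first.
  rewrite scale1r -e1; split; congr (_ * _ * _); congr xprod; apply/setP=> m;
    rewrite !inE; case mQ: (m \in Q) => //=;
    (have: m != i by apply/eqP=> mi; rewrite -mi mQ in iQ);
    by rewrite -val_eqE /=; case: ltngtP.
have e2 : 'X_[set m in Q | (m < i)%N] * 'X_[set m in Q | (i < m)%N] = 'X_(Q :\ i).
  rewrite -xprodU => [|j k].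
    congr xprod; apply/setP=> m; rewrite !inE -val_eqE /=.
    by case: (m \in Q); rewrite ?andbF ?andbT //=; case: ltngtP.
  by rewrite !inE => /andP[_ ji] /andP[_]; apply: ltn_trans.
have -> : [set m in Q | (i <= m)%N] = [set i] :|: [set m in Q | (i < m)%N].
  by apply/setP=> m; rewrite !inE -val_eqE /=;
    case: ltngtP => [||/val_inj <-]; rewrite ?iQ ?andbT ?andbF.
have -> : [set m in Q | (m <= i)%N] = i |: [set m in Q | (m < i)%N].
  by apply/setP=> m; rewrite !inE -val_eqE /=;
    case: ltngtP => [||/val_inj ->]; rewrite ?iQ ?andbT ?andbF.
rewrite xprodU => [|j k]; last by rewrite !inE => /eqP -> /andP[].
rewrite xprodU1 => [|j]; last by rewrite !inE => /andP[].
rewrite xprod1 !mulrA -[_ * X i * X i]mulrA cl_XX -scalerAr mulr1 -scalerAl e2.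
by [].
Qed.

(** X_i passes only the factors of larger index, each leaving a lambda term, and is then absorbed by
    [xprod_toggle]. *)
Lemma xprodMX Q i : 'X_Q * X i =
  \sum_(l in Q | (i < l)%N) ((-1) ^+ hi Q l * lam l i) *: 'X_(Q :\ l)
  + ((-1) ^+ hi Q i * toggle_coef i Q) *: 'X_(toggle i Q).
Proof.
have split_i R : (forall m, m \in R -> (i < m)%N) ->
    'X_[set m in Q | (m <= i)%N] * 'X_R = 'X_([set m in Q | (m <= i)%N] :|: R).
  by move=> iR; rewrite xprodU // => j m; rewrite !inE => /andP[_ ji] /iR; apply: leq_ltn_trans.
have -> : 'X_Q = 'X_[set m in Q | (m <= i)%N] * 'X_[set m in Q | (i < m)%N].
  rewrite split_i => [|m]; last by rewrite inE => /andP[].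
  by congr xprod; apply/setP=> m; rewrite !inE -andb_orr; case: leqP; rewrite ?andbT.
rewrite -mulrA (xprod_mulr (u := X i) (kappa := fun l => lam l i)) => [|l]; last first.
  by rewrite inE => /andP[_ il]; apply: cl_XXl; rewrite -val_eqE gtn_eqF.
rewrite mulrDr -scalerAr mulrA (xprod_toggle i Q).2 scalerA addrC mulr_sumr.
congr (_ + _); apply: eq_big => [l|l]; rewrite inE // => /andP[lQ il].
rewrite -scalerAr split_i => [|m]; last by rewrite !inE => /and3P[].
congr (_ *: _); [congr (_ ^+ _ * _) | congr xprod].
  by apply: eq_card => m; rewrite !inE; case: (ltnP l m);
    rewrite ?andbF // => /(ltn_trans il) ->; rewrite andbT.
apply/setP=> m; rewrite !inE; case: eqP => [->|_]; first by rewrite leqNgt il andbF.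
by rewrite -andb_orr; case: leqP; rewrite ?andbT.
Qed.

Lemma xprodXM Q i : X i * 'X_Q =
  \sum_(l in Q | (l < i)%N) ((-1) ^+ lo Q l * lam l i) *: 'X_(Q :\ l)
  + ((-1) ^+ lo Q i * toggle_coef i Q) *: 'X_(toggle i Q).
Proof.
have split_i R : (forall m, m \in R -> (m < i)%N) ->
    'X_R * 'X_[set m in Q | (i <= m)%N] = 'X_(R :|: [set m in Q | (i <= m)%N]).
  by move=> Ri; rewrite xprodU // => j m; rewrite !inE => /Ri ji /andP[_]; apply: leq_trans.
have -> : 'X_Q = 'X_[set m in Q | (m < i)%N] * 'X_[set m in Q | (i <= m)%N].
  rewrite split_i => [|m]; last by rewrite inE => /andP[].
  by congr xprod; apply/setP=> m; rewrite !inE -andb_orr; case: leqP; rewrite ?andbT ?orbT.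
rewrite mulrA (xprod_mull (u := X i) (kappa := fun l => lam l i)) => [|l]; last first.
  by rewrite inE => /andP[_ il]; apply: cl_XXl; rewrite -val_eqE ltn_eqF.
rewrite mulrDl -scalerAl (xprod_toggle i Q).1 scalerA addrC mulr_suml.
congr (_ + _); apply: eq_big => [l|l]; rewrite inE // => /andP[lQ il].
rewrite -scalerAl split_i => [|m]; last by rewrite !inE => /and3P[].
congr (_ *: _); [congr (_ ^+ _ * _) | congr xprod].
  by apply: eq_card => m; rewrite !inE; case: (ltnP m l);
    rewrite ?andbF // => /ltn_trans ->; rewrite ?andbT.
apply/setP=> m; rewrite !inE; case: eqP => [->|_]; first by rewrite (leqNgt i) il andbF.
by case: (ltnP m i); rewrite ?andbF ?andbT ?orbF ?orbT.
Qed.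

Definition xcomb (c : {set 'I_n} -> K) : A := \sum_(Q : {set 'I_n}) c Q *: 'X_Q.

Lemma xcombD c d : xcomb c + xcomb d = xcomb (fun Q => c Q + d Q).
Proof. by rewrite -big_split; apply: eq_bigr => Q _; rewrite scalerDl. Qed.

Lemma xcombZ a c : a *: xcomb c = xcomb (fun Q => a * c Q).
Proof. by rewrite scaler_sumr; apply: eq_bigr => Q _; rewrite scalerA. Qed.

Lemma xcomb_sum (f : {set 'I_n} -> 'I_n -> K) (p : pred 'I_n) :
  \sum_(Q : {set 'I_n}) \sum_(l in Q | p l) f Q l *: 'X_(Q :\ l)
  = xcomb (fun R => \sum_(l in ~: R | p l) f (l |: R) l).
Proof.
under eq_bigr do rewrite big_mkcondr.
rewrite (sum_in_setU1 (fun Q l => if p l then f Q l *: 'X_(Q :\ l) else 0)).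
apply: eq_bigr => R _; rewrite -big_mkcondr scaler_suml; apply: eq_bigr => l.
by rewrite inE => /andP[lR _]; rewrite setU1K.
Qed.

Lemma xcomb_toggle i (f : {set 'I_n} -> K) :
  \sum_(Q : {set 'I_n}) f Q *: 'X_(toggle i Q) = xcomb (fun R => f (toggle i R)).
Proof.
rewrite (reindex_inj (inv_inj (toggleK i))); apply: eq_bigr => Q _.
by rewrite toggleK.
Qed.

Lemma hi_toggle i Q : hi (toggle i Q) i = hi Q i.
Proof.
by apply: eq_card => m; rewrite /toggle; case: ifP => _; rewrite !inE;
  case: eqP => // ->; rewrite ltnn ?andbF.
Qed.

Lemma lo_toggle i Q : lo (toggle i Q) i = lo Q i.
Proof.
by apply: eq_card => m; rewrite /toggle; case: ifP => _; rewrite !inE;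
  case: eqP => // ->; rewrite ltnn ?andbF.
Qed.

Lemma xcombMX c i : xcomb c * X i = xcomb (fun R =>
  \sum_(l in ~: R | (i < l)%N) (-1) ^+ hi R l * lam l i * c (l |: R)
  + (-1) ^+ hi R i * toggle_coef i (toggle i R) * c (toggle i R)).
Proof.
rewrite /xcomb mulr_suml.
under eq_bigr do rewrite -scalerAl xprodMX scalerDr scaler_sumr scalerA.
rewrite big_split /=; under eq_bigr do under eq_bigr do rewrite scalerA.
rewrite (xcomb_sum (fun Q l => c Q * ((-1) ^+ hi Q l * lam l i))).
rewrite (xcomb_toggle i (fun Q => c Q * ((-1) ^+ hi Q i * toggle_coef i Q))) xcombD.
apply: eq_bigr => R _; congr ((_ + _) *: _); last by rewrite mulrC hi_toggle.
by apply: eq_bigr => l _; rewrite mulrC hiU1.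
Qed.

Lemma xcombXM c i : X i * xcomb c = xcomb (fun R =>
  \sum_(l in ~: R | (l < i)%N) (-1) ^+ lo R l * lam l i * c (l |: R)
  + (-1) ^+ lo R i * toggle_coef i (toggle i R) * c (toggle i R)).
Proof.
rewrite /xcomb mulr_sumr.
under eq_bigr do rewrite -scalerAr xprodXM scalerDr scaler_sumr scalerA.
rewrite big_split /=; under eq_bigr do under eq_bigr do rewrite scalerA.
rewrite (xcomb_sum (fun Q l => c Q * ((-1) ^+ lo Q l * lam l i))).
rewrite (xcomb_toggle i (fun Q => c Q * ((-1) ^+ lo Q i * toggle_coef i Q))) xcombD.
apply: eq_bigr => R _; congr ((_ + _) *: _); last by rewrite mulrC lo_toggle.
by apply: eq_bigr => l _; rewrite mulrC loU1.
Qed.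

Lemma xcombMG c : xcomb c * G = G * xcomb (fun Q => (-1) ^+ #|Q| * c Q)
  + xcomb (fun R => \sum_(i in ~: R) (-1) ^+ hi R i * gamma i * c (i |: R)).
Proof.
rewrite /xcomb mulr_suml mulr_sumr.
under eq_bigr do rewrite -scalerAl (xprod_mulr (fun l _ => cl_GX l)) scalerDr scaler_sumr.
rewrite big_split /=; congr (_ + _).
  by apply: eq_bigr => Q _; rewrite scalerA mulrC scalerAr.
under eq_bigr do under eq_bigr do rewrite scalerA.
rewrite (sum_in_setU1 (fun Q l => (c Q * ((-1) ^+ hi Q l * gamma l)) *: 'X_(Q :\ l))).
apply: eq_bigr => R _; rewrite scaler_suml; apply: eq_bigr => l.
by rewrite inE => lR; rewrite setU1K // mulrC hiU1.
Qed.

End Clifford.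

(** * Commutation with the generators in coordinates *)

Section CliffordCoef.
Variables (K : fieldType) (n : nat) (A : falgType K).
Variables (alpha : K) (beta gamma : 'I_n -> K) (lambda : 'I_n -> 'I_n -> K).
Variables (G : A) (X : 'I_n -> A).
Hypothesis rel : clifford_rel alpha beta gamma lambda G X.
Hypothesis mb : monomial_basis G X.
Implicit Types (P Q R : {set 'I_n}) (i r l m : 'I_n) (k : bool).
Implicit Types eta : bool -> {set 'I_n} -> K.
Local Notation "''X_' P" := (xprod X P) (at level 8, P at level 2).
Local Notation lam := (lam lambda).
Local Notation lo Q l := #|[set m in Q | (m < l)%N]|.
Local Notation hi Q l := #|[set m in Q | (l < m)%N]|.

Definition cl_elt eta : A := G * xcomb X (eta true) + xcomb X (eta false).

Lemma cl_eltE eta :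
  \sum_(k : bool) \sum_(Q : {set 'I_n}) eta k Q *: (G ^+ k * 'X_Q) = cl_elt eta.
Proof.
rewrite big_bool /= /cl_elt /xcomb mulr_sumr; congr (_ + _); apply: eq_bigr => Q _.
  by rewrite expr1 scalerAr.
by rewrite expr0 mul1r.
Qed.

Lemma cl_elt_pair eta :
  cl_elt eta = \sum_(p : bool * {set 'I_n}) eta p.1 p.2 *: (G ^+ p.1 * 'X_(p.2)).
Proof. by rewrite -cl_eltE pair_big. Qed.

Lemma cl_elt_onto a : exists eta, a = cl_elt eta.
Proof.
have [c ->] := codom_basis_expand mb a.
exists (fun k Q => c (k, Q)); rewrite cl_elt_pair.
by apply: eq_bigr => -[].
Qed.

Lemma cl_elt_inj eta eta' : cl_elt eta = cl_elt eta' -> forall k Q, eta k Q = eta' k Q.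
Proof.
rewrite !cl_elt_pair => e k Q.
exact: (@codom_basis_inj _ _ _ _ mb (fun p => eta p.1 p.2) (fun p => eta' p.1 p.2) e (k, Q)).
Qed.

Lemma cl_elt_eqP c1 c0 d1 d0 :
  G * xcomb X c1 + xcomb X c0 = G * xcomb X d1 + xcomb X d0 <->
  forall Q, c1 Q = d1 Q /\ c0 Q = d0 Q.
Proof.
pose eta (c d : {set 'I_n} -> K) (k : bool) := if k then c else d.
split=> [|cd]; last first.
  by congr (_ * _ + _); apply: eq_bigr => Q _; have [e1 e0] := cd Q; rewrite ?e1 ?e0.
rewrite -[LHS]/(cl_elt (eta c1 c0)) -[RHS]/(cl_elt (eta d1 d0)) => e Q.
by split; [apply: (cl_elt_inj e true) | apply: (cl_elt_inj e false)].
Qed.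

(** Comparing coefficients yields the stated scalar equations only up to an overall sign, which is e
    in the applications. *)
Lemma iff_scale (e a b a' b' : K) : e != 0 -> a - b = e * (a' - b') -> (a = b <-> a' = b').
Proof.
move=> e0 E; split=> /eqP; rewrite -subr_eq0.
  by rewrite E mulf_eq0 (negPf e0) /= subr_eq0 => /eqP.
by move=> h; apply/eqP; rewrite -subr_eq0 E (eqP h) mulr0.
Qed.

(** Since G^2 = alpha, multiplication by G exchanges the two coordinate families: the coefficient of
    G X_Q gives the equation with k = 0, that of X_Q the one with k = 1. *)
Lemma comm_GP p eta :
  (-1) ^+ p *: (G * cl_elt eta) = cl_elt eta * G <->
  forall Q k, ((-1) ^+ p + (-1) ^+ (#|Q| + 1)) * alpha ^+ k * eta k Q
    = \sum_(i in ~: Q) (-1) ^+ sexp Q (i |: Q) * gamma i * eta (~~ k) (i |: Q).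
Proof.
pose S k Q := \sum_(i in ~: Q) (-1) ^+ hi Q i * gamma i * eta k (i |: Q).
have SE k Q : \sum_(i in ~: Q) (-1) ^+ sexp Q (i |: Q) * gamma i * eta k (i |: Q) = S k Q.
  by apply: eq_bigr => i; rewrite inE => iQ; rewrite sexpC1.
have -> : (-1) ^+ p *: (G * cl_elt eta) =
    G * xcomb X (fun Q => (-1) ^+ p * eta false Q)
    + xcomb X (fun Q => (-1) ^+ p * (alpha * eta true Q)).
  rewrite /cl_elt mulrDr mulrA (cl_GG rel) -scalerAl mul1r xcombZ addrC scalerDr.
  by rewrite scalerAr !xcombZ.
have -> : cl_elt eta * G =
    G * xcomb X (fun Q => S true Q + (-1) ^+ #|Q| * eta false Q)
    + xcomb X (fun Q => alpha * ((-1) ^+ #|Q| * eta true Q) + S false Q).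
  rewrite /cl_elt mulrDl -mulrA !(xcombMG rel) mulrDr mulrA (cl_GG rel) -scalerAl mul1r.
  by rewrite xcombZ -!xcombD mulrDr [X in X + _ = _]addrC addrACA.
rewrite cl_elt_eqP.
have Ef Q : (-1) ^+ p * eta false Q = S true Q + (-1) ^+ #|Q| * eta false Q <->
    ((-1) ^+ p + (-1) ^+ (#|Q| + 1)) * alpha ^+ 0 * eta false Q = S true Q.
  by apply: (iff_scale (oner_neq0 K)); rewrite exprD expr0 expr1; ring.
have Et Q : (-1) ^+ p * (alpha * eta true Q)
      = alpha * ((-1) ^+ #|Q| * eta true Q) + S false Q <->
    ((-1) ^+ p + (-1) ^+ (#|Q| + 1)) * alpha ^+ 1 * eta true Q = S false Q.
  by apply: (iff_scale (oner_neq0 K)); rewrite exprD !expr1; ring.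
split=> h Q; first by case; rewrite SE; [apply/Et | apply/Ef]; case: (h Q).
by split; [apply/Ef | apply/Et]; rewrite -SE; [exact: (h Q false) | exact: (h Q true)].
Qed.

(** The lambda contributions to the coefficient at R: left multiplication by X_i produces those with
    l < i, right multiplication those with l > i. Both sums carry the sign of left multiplication;
    [upper_sum_hi] converts the other one. *)
Definition lower_sum i (c : {set 'I_n} -> K) R :=
  \sum_(l in ~: R | (l < i)%N) (-1) ^+ lo R l * lam l i * c (l |: R).
Definition upper_sum i (c : {set 'I_n} -> K) R :=
  \sum_(l in ~: R | (i < l)%N) (-1) ^+ lo R l * lam l i * c (l |: R).

Lemma lower_sumU1 i Q c d (e : 'I_n -> nat) :
  (forall l, e l = sexp [set l] (Q :|: [set i; l]) + d)%N ->
  \sum_(l in ~: Q | (l < i)%N) (-1) ^+ e l * lam l i * c (Q :|: [set i; l])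
  = (-1) ^+ d * lower_sum i c (i |: Q).
Proof.
move=> eE; rewrite mulr_sumr; apply: eq_big => [l|l].
  by rewrite !inE -val_eqE /=; case: ltngtP; rewrite ?andbF.
rewrite inE => /andP[lQ li]; rewrite eE.
have -> : Q :|: [set i; l] = l |: (i |: Q).
  by apply/setP=> m; rewrite !inE; do !case: eqP; case: (m \in Q).
by rewrite sexp1 ?setU11 // loU1 exprD; ring.
Qed.

Lemma upper_sumU1 i Q c d (e : 'I_n -> nat) :
  (forall l, e l = sexp [set l] (Q :|: [set i; l]) + d)%N ->
  \sum_(l in ~: Q | (i < l)%N) (-1) ^+ e l * lam l i * c (Q :|: [set i; l])
  = (-1) ^+ d * upper_sum i c (i |: Q).
Proof.
move=> eE; rewrite mulr_sumr; apply: eq_big => [l|l].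
  by rewrite !inE -val_eqE /=; case: ltngtP; rewrite ?andbF.
rewrite inE => /andP[lQ li]; rewrite eE.
have -> : Q :|: [set i; l] = l |: (i |: Q).
  by apply/setP=> m; rewrite !inE; do !case: eqP; case: (m \in Q).
by rewrite sexp1 ?setU11 // loU1 exprD; ring.
Qed.

Lemma lower_sumE i Q c d (e : 'I_n -> nat) :
  (forall l, e l = sexp [set l] (l |: Q) + d)%N ->
  \sum_(l in ~: Q | (l < i)%N) (-1) ^+ e l * lam l i * c (l |: Q)
  = (-1) ^+ d * lower_sum i c Q.
Proof.
move=> eE; rewrite mulr_sumr; apply: eq_bigr => l _; rewrite eE.
by rewrite sexp1 ?setU11 // loU1 exprD; ring.
Qed.

Lemma upper_sumE i Q c d (e : 'I_n -> nat) :
  (forall l, e l = sexp [set l] (l |: Q) + d)%N ->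
  \sum_(l in ~: Q | (i < l)%N) (-1) ^+ e l * lam l i * c (l |: Q)
  = (-1) ^+ d * upper_sum i c Q.
Proof.
move=> eE; rewrite mulr_sumr; apply: eq_bigr => l _; rewrite eE.
by rewrite sexp1 ?setU11 // loU1 exprD; ring.
Qed.

Lemma upper_sum_hi i c R :
  \sum_(l in ~: R | (i < l)%N) (-1) ^+ hi R l * lam l i * c (l |: R)
  = (-1) ^+ #|R| * upper_sum i c R.
Proof.
rewrite mulr_sumr; apply: eq_bigr => l; rewrite inE => /andP[lR _].
rewrite !mulrA -exprD; congr (_ * _ * _); apply: sign_eq.
by rewrite -(card_lt_gt R l) (negPf lR); parity.
Qed.

Lemma sign_cases (m : nat) : (-1) ^+ m = 1 :> K \/ (-1) ^+ m = -1 :> K.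
Proof. by rewrite -signr_odd; case: odd; [right | left]. Qed.

(** Every set is Q or Q + i with i outside Q. The coefficients of G X_(Q+i), G X_Q, X_(Q+i) and X_Q
    give the four equalities of (b), in this order. *)
Lemma comm_XP P i eta :
  (-1) ^+ #|P| *: (X i * cl_elt eta) = cl_elt eta * X i <->
  forall Q, i \notin Q ->
    [/\ eta_condition_b1 lambda P Q eta i, eta_condition_b2 beta lambda P Q eta i,
        eta_condition_b3 gamma lambda P Q eta i &
        eta_condition_b4 beta gamma lambda P Q eta i].
Proof.
pose lX c R := lower_sum i c R + (-1) ^+ lo R i * toggle_coef beta i (toggle i R) * c (toggle i R).
pose rX c R := (-1) ^+ #|R| * upper_sum i c R
  + (-1) ^+ hi R i * toggle_coef beta i (toggle i R) * c (toggle i R).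
have -> : (-1) ^+ #|P| *: (X i * cl_elt eta) =
    G * xcomb X (fun R => (-1) ^+ #|P| * - lX (eta true) R)
    + xcomb X (fun R => (-1) ^+ #|P| * (gamma i * eta true R + lX (eta false) R)).
  rewrite /cl_elt mulrDr mulrA.
  have /(canRL (addKr _)) -> := cl_GX rel i.
  rewrite mulrDl mulNr -mulrA -scalerAl mul1r !(xcombXM rel).
  have Z c : xcomb X (fun R => (-1) ^+ #|P| * c R) = (-1) ^+ #|P| *: xcomb X c.
    by rewrite xcombZ.
  rewrite (Z (fun R => - lX (eta true) R)) (Z (fun R => gamma i * eta true R + _)).
  rewrite -scalerAr -scalerDr -(xcombD X (fun R => gamma i * eta true R)) -addrA xcombZ.
  congr (_ *: (_ + _)).
  rewrite -mulrN /xcomb -sumrN; congr (_ * _).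
  by apply: eq_bigr => R _; rewrite scaleNr.
have -> : cl_elt eta * X i = G * xcomb X (rX (eta true)) + xcomb X (rX (eta false)).
  rewrite /cl_elt mulrDl -mulrA !(xcombMX rel); congr (_ * _ + _);
  by apply: eq_bigr => R _; rewrite upper_sum_hi.
rewrite cl_elt_eqP.
pose b Q := [/\ eta_condition_b1 lambda P Q eta i, eta_condition_b2 beta lambda P Q eta i,
        eta_condition_b3 gamma lambda P Q eta i &
        eta_condition_b4 beta gamma lambda P Q eta i].
pose q R := (-1) ^+ #|P| * - lX (eta true) R = rX (eta true) R /\
     (-1) ^+ #|P| * (gamma i * eta true R + lX (eta false) R) = rX (eta false) R.
have key Q : i \notin Q -> (q (i |: Q) /\ q Q) <-> b Q.
  move=> iQ; pose p := #|P|; pose d := #|Q|.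
  have loE : (-1) ^+ lo Q i = (-1) ^+ d * (-1) ^+ hi Q i :> K.
    rewrite -exprD; apply: sign_eq.
    by rewrite /d -(card_lt_gt Q i) (negPf iQ); parity.
  have tQ : toggle i Q = i |: Q by rewrite /toggle (negPf iQ).
  have tiQ : toggle i (i |: Q) = Q by rewrite -tQ toggleK.
  have wQ : toggle_coef beta i Q = 1 by rewrite /toggle_coef (negPf iQ).
  have wiQ : toggle_coef beta i (i |: Q) = beta i by rewrite /toggle_coef setU11.
  have sz (m : nat) : (-1) ^+ m != 0 :> K by rewrite signr_eq0.
  have c1 : (-1) ^+ #|P| * - lX (eta true) (i |: Q) = rX (eta true) (i |: Q)
      <-> eta_condition_b1 lambda P Q eta i.
    rewrite /eta_condition_b1 (@lower_sumU1 i Q _ (p + d)); last by move=> l; rewrite addnA.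
    rewrite (@upper_sumU1 i Q _ (1)) // sexpC1 //; apply: (iff_scale (sz d)).
    rewrite /lX /rX tiQ wQ loU1 hiU1 loE cardsU1 iQ !exprD !expr1 -/p -/d.
    by case: (sign_cases p) => ->; case: (sign_cases d) => ->; ring.
  have c2 : (-1) ^+ #|P| * - lX (eta true) Q = rX (eta true) Q
      <-> eta_condition_b2 beta lambda P Q eta i.
    rewrite /eta_condition_b2 (@lower_sumE i Q _ (p + d + 1)); last by move=> l; rewrite !addnA.
    rewrite (@upper_sumE i Q _ (1)) // sexpC1 //; apply: (iff_scale (sz d.+1)).
    rewrite /lX /rX tQ wiQ loE exprS !exprD !expr1 -/p -/d.
    by case: (sign_cases p) => ->; case: (sign_cases d) => ->; ring.
  have c3 : (-1) ^+ #|P| * (gamma i * eta true (i |: Q) + lX (eta false) (i |: Q))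
        = rX (eta false) (i |: Q) <-> eta_condition_b3 gamma lambda P Q eta i.
    rewrite /eta_condition_b3 (@lower_sumU1 i Q _ (1)) //.
    rewrite (@upper_sumU1 i Q _ (p + d + 1)); last by move=> l; rewrite !addnA.
    rewrite sexpC1 //; apply: (iff_scale (sz p)).
    rewrite /lX /rX tiQ wQ loU1 hiU1 loE cardsU1 iQ !exprD !expr1 -/p -/d.
    by case: (sign_cases p) => ->; case: (sign_cases d) => ->; ring.
  have c4 : (-1) ^+ #|P| * (gamma i * eta true Q + lX (eta false) Q) = rX (eta false) Q
      <-> eta_condition_b4 beta gamma lambda P Q eta i.
    rewrite /eta_condition_b4 (@lower_sumE i Q _ (1)) //.
    rewrite (@upper_sumE i Q _ (p + d)); last by move=> l; rewrite !addnA.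
    rewrite sexpC1 //; apply: (iff_scale (sz p)).
    rewrite /lX /rX tQ wiQ loE !exprD !expr1 -/p -/d.
    by case: (sign_cases p) => ->; case: (sign_cases d) => ->; ring.
  split=> [[[/c1 ? /c3 ?] [/c2 ? /c4 ?]]|[/c1 ? /c2 ? /c3 ? /c4 ?]] //.
split=> [h Q iQ|h R]; first by apply/(key Q iQ); split; apply: h.
case: (boolP (i \in R)) => iR; last by case/(key _ iR): (h _ iR).
have iR' : i \notin R :\ i by rewrite setD11.
by case/(key _ iR'): (h _ iR'); rewrite setD1K.
Qed.

End CliffordCoef.

(* Unification would otherwise unfold tensors to their matrices of coordinates. *)
Local Opaque tlift tensor tens_mul.

(** * The integral axioms *)

Section Coaction.
Variables (K : fieldType) (n : nat) (E : hopf_algebra K) (g : E) (x : 'I_n -> E).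
Hypothesis EnE : is_En g x.
Variables (A : comodule_algebra E) (G : A) (X : 'I_n -> A).
Hypotheses (mb : monomial_basis G X) (rhoA : canonical_coaction g x G X).
Local Notation Si := (@antipode_inv K E).
Local Notation B := (tens A E).
Implicit Types (t : B) (a b : A) (h : E).

Lemma coactG : coact G = G \ox g. Proof. by case: rhoA. Qed.
Lemma coactX i : coact (X i) = X i \ox g + 1 \ox x i. Proof. by case: rhoA. Qed.

Lemma tens1 (C D : falgType K) : (1 : C) \ox (1 : D) = 1. Proof. by []. Qed.

Lemma tensC a (c : E) : (1 \ox c) * (a \ox 1) = (a \ox 1) * (1 \ox c) :> B.
Proof. by rewrite !tensorM !mulr1 !mul1r. Qed.

Definition twist a : B := tlift (fun (a0 : A) (a1 : E) => a0 \ox Si a1) (coact a).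

Fact twist_linear : linear twist.
Proof. by move=> k u v; rewrite /twist !linearP. Qed.
HB.instance Definition _ := GRing.isLinear.Build K A B _ twist twist_linear.

Let twB : bilin (fun (a0 : A) (a1 : E) => a0 \ox Si a1).
Proof. by bilt. Qed.

Lemma coact1 : coact (1 : A) = 1 \ox 1. Proof. exact: rmorph1. Qed.
Lemma comul1 : comul (1 : E) = 1 \ox 1. Proof. exact: rmorph1. Qed.

Lemma twist1 : twist 1 = 1 \ox 1.
Proof. by rewrite /twist coact1 tliftT // (antipode_inv1 EnE). Qed.

(** S^-1 reverses products, so twist is multiplicative into A (x) E^op; in the ordinary product of
    E, a left factor of a acts on the right in the second leg. *)
Lemma twist_GM a : twist (G * a) = (G \ox 1) * twist a * (1 \ox g).
Proof.
rewrite /twist rmorphM /= coactG tlift_mull // mul_tlift tlift_mul.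
apply: eq_tlift => u v.
by rewrite (antipode_invM EnE) (antipode_invg EnE) !tensorM mulr1 mul1r.
Qed.

Lemma twist_MG a : twist (a * G) = (1 \ox g) * twist a * (G \ox 1).
Proof.
rewrite /twist rmorphM /= coactG tlift_mulr // mul_tlift tlift_mul.
apply: eq_tlift => u v.
by rewrite (antipode_invM EnE) (antipode_invg EnE) !tensorM mulr1 mul1r.
Qed.

Lemma twist_XM i a :
  twist (X i * a) = (X i \ox 1) * twist a * (1 \ox g) + twist a * (1 \ox (x i * g)).
Proof.
rewrite /twist rmorphM /= coactX mulrDl linearD /= !tlift_mull // mul_tlift !tlift_mul.
congr (_ + _); apply: eq_tlift => u v.
  by rewrite (antipode_invM EnE) (antipode_invg EnE) !tensorM mulr1 mul1r.
by rewrite (antipode_invM EnE) (antipode_invx EnE) !tensorM mulr1 mul1r.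
Qed.

Lemma twist_MX i a :
  twist (a * X i) = (1 \ox g) * twist a * (X i \ox 1) + (1 \ox (x i * g)) * twist a.
Proof.
rewrite /twist rmorphM /= coactX mulrDr linearD /= !tlift_mulr // !mul_tlift !tlift_mul.
congr (_ + _); apply: eq_tlift => u v.
  by rewrite (antipode_invM EnE) (antipode_invg EnE) !tensorM mulr1 mul1r.
by rewrite (antipode_invM EnE) (antipode_invx EnE) !tensorM mulr1 mul1r.
Qed.

Definition counit_r t : A := tlift (fun (a : A) (l : E) => counit l *: a) t.

Fact counit_r_linear : linear counit_r.
Proof. exact: tlift_linear. Qed.
HB.instance Definition _ := GRing.isLinear.Build K B A _ counit_r counit_r_linear.

Let counit_rB : bilin (fun (a : A) (l : E) => counit l *: a).
Proof.
split=> w k u v /=; first by rewrite scalerDr !scalerA mulrC.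
by rewrite linearP /= scalerDl scalerA.
Qed.

Lemma counit_r_mul u v t : counit_r ((u \ox 1) * t * (1 \ox v)) = counit v *: (u * counit_r t).
Proof.
elim/tens_ind: t => [k s t IHs IHt|a l].
  by rewrite mulPr mulPl !linearP /= IHs IHt mulPr scalerDr !scalerA mulrC.
rewrite !tensorM /counit_r !tliftT // mulr1 mul1r rmorphM /=.
by rewrite -scalerAr scalerA mulrC.
Qed.

Lemma twistK : cancel twist counit_r.
Proof.
elim/(monomial_ind mb) => [k a b IHa IHb||a IH|i a IH].
- by rewrite !linearP /= IHa IHb.
- by rewrite twist1 /counit_r tliftT // rmorph1 scale1r.
- by rewrite twist_GM counit_r_mul IH (En_counitg EnE) scale1r.
rewrite twist_XM linearD /= counit_r_mul IH (En_counitg EnE) scale1r.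
rewrite -[twist a]mul1r -[1]tens1 counit_r_mul rmorphM /= (En_counitx EnE).
by rewrite mul0r scale0r addr0.
Qed.

(** The map a (x) l -> a_0 (x) l a_1, which the counit extracts from psi; [retwist], that is a (x) l
    -> a_0 (x) l S^-1(a_1), is a left inverse of it. *)
Definition untwist t : B := tlift (fun (a : A) (l : E) => (1 \ox l) * coact a) t.
Definition retwist t : B := tlift (fun (a : A) (l : E) => (1 \ox l) * twist a) t.

Fact untwist_linear : linear untwist. Proof. exact: tlift_linear. Qed.
HB.instance Definition _ := GRing.isLinear.Build K B B _ untwist untwist_linear.
Fact retwist_linear : linear retwist. Proof. exact: tlift_linear. Qed.
HB.instance Definition _ := GRing.isLinear.Build K B B _ retwist retwist_linear.

Let untwistB : bilin (fun (a : A) (l : E) => (1 \ox l) * coact a). Proof. by bilt. Qed.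
Let retwistB : bilin (fun (a : A) (l : E) => (1 \ox l) * twist a). Proof. by bilt. Qed.

(** In Sweedler notation, a_0 (x) a_2 S^-1(a_1) = a (x) 1. *)
Lemma retwist_coact a : retwist (coact a) = a \ox 1.
Proof.
elim/(monomial_ind mb): a => [k a b IHa IHb||a IH|i a IH].
- by rewrite !linearP /= IHa IHb tensorPl.
- by rewrite coact1 /retwist tliftT // twist1 tensorM !mulr1.
- rewrite rmorphM /= coactG /retwist tlift_mull //.
  transitivity ((G \ox g) * retwist (coact a) * (1 \ox g)).
    rewrite /retwist mul_tlift tlift_mul; apply: eq_tlift => u v.
    by rewrite twist_GM !mulrA !tensorM !mulr1 !mul1r.
  by rewrite IH !tensorM !mulr1 (En_gg EnE).
rewrite rmorphM /= coactX /retwist mulrDl linearD /= !tlift_mull //.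
transitivity ((X i \ox g) * retwist (coact a) * (1 \ox g)
  + (1 \ox g) * retwist (coact a) * (1 \ox (x i * g)) + (1 \ox x i) * retwist (coact a)).
  rewrite /retwist !mul_tlift !tlift_mul; congr (_ + _); last first.
    by apply: eq_tlift => u v; rewrite mul1r mulrA tensorM mul1r.
  apply: tliftD => u v.
  by rewrite twist_XM mulrDr !mulrA !tensorM !mulr1 !mul1r.
(* The last two terms are a (x) g x_i g and a (x) x_i, which cancel. *)
rewrite IH !tensorM !mulr1 !mul1r (En_gg EnE) (En_xg EnE) mulrN mulrA (En_gg EnE).
by rewrite mul1r linearN /= subrK.
Qed.

Lemma tlift_tensor_id (V W : vectType K) (t : tens V W) :
  tlift (fun v w => v \ox w) t = t.
Proof. by rewrite {2}[t]tens_decomp. Qed.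

Lemma retwist_mull l t : retwist ((1 \ox l) * t) = (1 \ox l) * retwist t.
Proof.
rewrite /retwist tlift_mull // mul_tlift; apply: eq_tlift => u v.
by rewrite mulrA tensorM !mul1r.
Qed.

Lemma untwistK : cancel untwist retwist.
Proof.
pose L : {linear B -> B} := retwist \o untwist.
move=> t; rewrite -[LHS]/(L t) -[RHS]/(idfun t); apply: tens_ext => a l /=.
by rewrite /untwist tliftT // retwist_mull retwist_coact tensorM mul1r mulr1.
Qed.

(* psi(u \ox t), with u fixed. *)
Definition psi_at (u : E) t : tens B E :=
  tlift (fun (a : A) (l : E) =>
    tlift (fun (a0 : A) (a1 : E) =>
      tlift (fun l1 l2 : E => (a0 \ox l1) \ox (l2 * u * a1)) (comul l))
    (coact a)) t.

Let psi_atB u : bilin (fun (a : A) (l : E) =>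
    tlift (fun (a0 : A) (a1 : E) =>
      tlift (fun l1 l2 : E => (a0 \ox l1) \ox (l2 * u * a1)) (comul l))
    (coact a)).
Proof. by bilt. Qed.

Let psi_atB1 u l : bilin (fun (a0 : A) (a1 : E) =>
      tlift (fun l1 l2 : E => (a0 \ox l1) \ox (l2 * u * a1)) (comul l)).
Proof. by bilt. Qed.

Let psi_atB2 u (a0 : A) (a1 : E) : bilin (fun l1 l2 : E => (a0 \ox l1) \ox (l2 * u * a1)).
Proof. by bilt. Qed.

Fact psi_at_linear u : linear (psi_at u). Proof. exact: tlift_linear. Qed.
HB.instance Definition _ u := GRing.isLinear.Build K B (tens B E) _ (psi_at u) (psi_at_linear u).

Lemma psi_at_tlift (V W : vectType K) u (f : V -> W -> B) (s : tens V W) :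
  psi_at u (tlift f s) = tlift (fun v w => psi_at u (f v w)) s.
Proof. by rewrite /psi_at tlift_comp. Qed.

Fact psi_at_linearl t : linear (psi_at ^~ t). Proof. by rewrite /psi_at; lin. Qed.

Lemma psi_at_bilin : bilin psi_at.
Proof. by split=> w; [apply: psi_at_linearl | apply: psi_at_linear]. Qed.

Lemma psi_atPl t k u v : psi_at (k *: u + v) t = k *: psi_at u t + psi_at v t.
Proof. exact: psi_at_linearl. Qed.

Lemma psi_atNl t u : psi_at (- u) t = - psi_at u t.
Proof.
have psi0 : psi_at 0 t = 0.
  by rewrite -(addNr 0) -scaleN1r psi_atPl scaleN1r addNr.
by rewrite -[- u]addr0 -scaleN1r psi_atPl psi0 addr0 scaleN1r.
Qed.

Let psi_atB3 u t : bilin (fun k1 k2 : E => psi_at (k2 * u) t * ((1 \ox k1) \ox 1)).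
Proof.
split=> w k a b /=; first by rewrite linearP tensorPl mulPr.
by rewrite mulPl psi_atPl mulPl.
Qed.

(** Replacing l by l k turns l_1 (x) l_2 u a_1 into l_1 k_1 (x) l_2 k_2 u a_1: k_2 joins u, while
    k_1 stays as a right factor of the middle leg. *)
Lemma psi_at_mulr u t k :
  psi_at u (t * (1 \ox k)) =
  tlift (fun k1 k2 : E => psi_at (k2 * u) t * ((1 \ox k1) \ox 1)) (comul k).
Proof.
rewrite /psi_at tlift_mulr //.
transitivity (tlift (fun k1 k2 : E => tlift (fun (a : A) (l : E) =>
    tlift (fun (a0 : A) (a1 : E) =>
      tlift (fun l1 l2 : E => (a0 \ox (l1 * k1)) \ox (l2 * (k2 * u) * a1)) (comul l))
    (coact a)) t) (comul k)); last first.
  apply: eq_tlift => u1 u2; rewrite tlift_mul; apply: eq_tlift => a l.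
  rewrite tlift_mul; apply: eq_tlift => a0 a1; rewrite tlift_mul.
  by apply: eq_tlift => l1 l2; rewrite !tensorM !mulr1.
rewrite [RHS]tlift_tlift; apply: eq_tlift => a l; rewrite mulr1.
rewrite [RHS]tlift_tlift; apply: eq_tlift => a0 a1; rewrite rmorphM /=.
elim/tens_ind: (comul k) => [c s s' IH IH'|k1 k2].
  by rewrite mulPr !linearP /= IH IH'.
rewrite tlift_mulr // tliftT; last by bilt.
by apply: eq_tlift => l1 l2; rewrite !mulrA.
Qed.

Lemma psi_at_Gmul u t : psi_at u ((G \ox 1) * t) = ((G \ox 1) \ox 1) * psi_at (u * g) t.
Proof.
rewrite /psi_at tlift_mull // mul_tlift; apply: eq_tlift => a l.
rewrite mul1r rmorphM /= coactG tlift_mull // mul_tlift; apply: eq_tlift => a0 a1.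
by rewrite mul_tlift; apply: eq_tlift => l1 l2; rewrite !tensorM !mul1r !mulrA.
Qed.

Lemma psi_at_Xmul i u t :
  psi_at u ((X i \ox 1) * t) = ((X i \ox 1) \ox 1) * psi_at (u * g) t + psi_at (u * x i) t.
Proof.
rewrite /psi_at tlift_mull // mul_tlift; apply: tliftD => a l.
rewrite mul1r rmorphM /= coactX mulrDl linearD /= !tlift_mull // mul_tlift.
congr (_ + _); apply: eq_tlift => a0 a1; last first.
  by apply: eq_tlift => l1 l2; rewrite !mul1r !mulrA.
by rewrite mul_tlift; apply: eq_tlift => l1 l2; rewrite !tensorM !mul1r !mulrA.
Qed.

Lemma psi_at_mulg u t : psi_at u (t * (1 \ox g)) = psi_at (g * u) t * ((1 \ox g) \ox 1).
Proof.
by rewrite psi_at_mulr (En_comulg EnE) (tliftT _ _ (psi_atB3 u t)).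
Qed.

Lemma psi_at_mulxg i u t : psi_at u (t * (1 \ox (x i * g))) =
  psi_at u t * ((1 \ox (x i * g)) \ox 1) + psi_at (x i * g * u) t * ((1 \ox g) \ox 1).
Proof.
rewrite psi_at_mulr rmorphM /= (En_comulg EnE) (En_comulx EnE) mulrDl linearD /=.
by rewrite !tensorM mul1r !(tliftT _ _ (psi_atB3 u t)) (En_gg EnE) mul1r.
Qed.

(** Formally, a_0 (x) S^-1(a_3) (x) S^-1(a_2) a_1 collapses to a_0 (x) S^-1(a_1) (x) 1. *)
Lemma psi_at_twist a : psi_at 1 (twist a) = twist a \ox 1.
Proof.
elim/(monomial_ind mb): a => [k a b IHa IHb||a IH|i a IH].
- by rewrite !linearP /= IHa IHb tensorPl.
- rewrite twist1 /psi_at (tliftT _ _ (psi_atB 1)) coact1 (tliftT _ _ (psi_atB1 1 1)) comul1.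
  by rewrite (tliftT _ _ (psi_atB2 1 1 1)) !mul1r.
- by rewrite twist_GM psi_at_mulg psi_at_Gmul mulr1 (En_gg EnE) IH !tensorM !mulr1.
rewrite twist_XM linearD /= psi_at_mulg psi_at_Xmul mulr1 (En_gg EnE) IH psi_at_mulxg IH.
(* The terms with x i between l_2 and a_1 cancel, as g x_i + x_i g = 0. *)
rewrite mulr1 (En_xg EnE) psi_atNl mulNr mulrDl -addrA [X in _ + X]addrCA subrr addr0.
by rewrite !tensorM !mulr1 -tensorDl.
Qed.

Lemma counit_r_psi_at t :
  tlift (fun (s : B) (k : E) => counit_r s \ox k) (psi_at 1 t) = untwist t.
Proof.
have bL : bilin (fun (s : B) (k : E) => counit_r s \ox k).
  by split=> w k u v /=; rewrite !linearP //= tensorPl.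
rewrite /psi_at tlift_comp; apply: eq_tlift => a l.
rewrite tlift_comp -[coact a in RHS]tlift_tensor_id mul_tlift.
apply: eq_tlift => a0 a1; rewrite tlift_comp tensorM mul1r.
rewrite -[l in RHS]counitl tlift_mul tlift_tensr; apply: eq_tlift => l1 l2.
rewrite (tliftT _ _ bL) /counit_r (tliftT _ _ counit_rB) mulr1.
by rewrite tensorZl -linearZ /= scalerAl.
Qed.

(* Applying the counit to the middle leg of psi(1 \ox t) = t \ox 1 gives        *)
(* a_0 \ox l a_1 = counit_r t \ox 1, which determines t by untwistK.           *)
Lemma psi_at_twistP t : psi_at 1 t = t \ox 1 <-> t = twist (counit_r t).
Proof.
split=> [Ot|->]; last exact: psi_at_twist.
have bL : bilin (fun (s : B) (k : E) => counit_r s \ox k).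
  by split=> w k u v /=; rewrite !linearP //= tensorPl.
rewrite -{1}[t]untwistK -counit_r_psi_at Ot (tliftT _ _ bL) /retwist (tliftT _ _ retwistB).
by rewrite [1 \ox 1]tens1 mul1r.
Qed.

End Coaction.

(** * Invertibility of the convolution *)

Section Conv.
Variables (K : fieldType) (n : nat) (E : hopf_algebra K) (g : E) (x : 'I_n -> E).
Hypothesis EnE : is_En g x.
Variables (C : falgType K) (iota : {linear E -> C}).
Hypotheses (iotaM : {morph iota : u v / u * v}) (iota1 : iota 1 = 1).
Local Notation Si := (@antipode_inv K E).

(** A convolution in the co-opposite order, with h_1 to the right of N(h_2); its inverse therefore
    involves S^-1 instead of S. *)
Definition conv_along (N : E -> C) (h : E) : C :=
  tlift (fun h1 h2 : E => N h2 * iota h1) (comul h).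

Lemma antipode_invr (h : E) :
  tlift (fun h1 h2 : E => h2 * Si h1) (comul h) = (counit h)%:A.
Proof.
have S_inj : injective (@antipode K E) by apply: bij_inj; exact: En_antipode_bij EnE.
apply: S_inj; rewrite linear_tlift linearZ /= (antipode1 E).
rewrite -antipoder; apply: eq_tlift => u v.
by rewrite (antipodeM EnE) (antipodeK EnE).
Qed.

(** Convolving once more, with iota S^-1, gives N(h_3) iota(h_2 S^-1(h_1)) = N(h). *)
Lemma conv_along_inj (N : {linear E -> C}) : (forall h, conv_along N h = 0) -> forall h, N h = 0.
Proof.
move=> N0 h.
pose Phi (u v w : E) := N w * iota (v * Si u).
have: tlift (fun h1 h2 : E => tlift (fun u v => Phi h1 u v) (comul h2)) (comul h) = 0.
  rewrite -(tlift0 C (comul h)); apply: eq_tlift => u v.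
  rewrite -[RHS](mul0r (iota (Si u))) -(N0 v) /conv_along tlift_mul.
  by apply: eq_tlift => ? ?; rewrite /Phi iotaM mulrA.
rewrite -coassoc => [|? ?|? ?|? ?]; rewrite ?/Phi; try by lin.
move=> <-; rewrite -{1}[h]counitl linear_tlift; apply: eq_tlift => u v.
rewrite -mul_tlift -linear_tlift antipode_invr !linearZ /= iota1.
by rewrite -scalerAr mulr1.
Qed.

End Conv.

Section Integral.
Variables (K : fieldType) (n : nat) (E : hopf_algebra K) (g : E) (x : 'I_n -> E).
Hypothesis EnE : is_En g x.
Variables (A : comodule_algebra E) (G : A) (X : 'I_n -> A).
Hypotheses (mb : monomial_basis G X) (rhoA : canonical_coaction g x G X).
Local Notation Si := (@antipode_inv K E).
Local Notation B := (tens A E).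
Implicit Types (t : B) (a b : A) (h : E).

Definition rconv (N : E -> B) h : B :=
  tlift (fun h1 h2 : E => N h2 * (1 \ox h1)) (comul h).

Fact rconv_linear N : linear (rconv N).
Proof. by move=> k u v; rewrite /rconv !linearP. Qed.
HB.instance Definition _ N := GRing.isLinear.Build K E B _ (rconv N) (rconv_linear N).

Lemma rconv_inj (N N' : E -> B) : linear N -> linear N' ->
  (forall h, rconv N h = rconv N' h) -> forall h, N h = N' h.
Proof.
move=> Nl Nl' NN h; apply/eqP; rewrite -subr_eq0; apply/eqP.
pose D h := N h - N' h.
have Dl : linear D by move=> k u v; rewrite /D Nl Nl' scalerBr opprD addrACA.
pose DL := GRing.isLinear.Build K E B _ D Dl.
pose D' : {linear E -> B} := HB.pack D DL.
rewrite -[LHS]/(D' h); apply: (conv_along_inj EnE (iota := tensor (1 : A))) => [u v||{}h].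
- by rewrite /= tensorM mulr1.
- by [].
have /eqP := NN h; rewrite -subr_eq0 => /eqP <-; rewrite [RHS]addrC -scaleN1r.
by apply: tlift_lin => u v /=; rewrite /D mulrBl addrC scaleN1r.
Qed.

(** With J(h) = psi(h_1 (x) T(h_2)), [psi_at_mulr] and coassociativity give psi(1 (x) w(h)) =
    J(h_2)(1 (x) h_1 (x) 1). Hence J(h) = T(h) (x) 1 for all h amounts to psi(1 (x) w(h)) = w(h) (x)
    1 for all h, and [psi_at_twistP] applies. *)
Lemma integral1P (T : {linear E -> B}) :
  (forall h, cowreath_psi (tlift (fun h1 h2 : E => h1 \ox T h2) (comul h)) = T h \ox 1)
  <-> forall h, rconv T h = twist (counit_r (rconv T h)).
Proof.
pose J h := tlift (fun h1 h2 : E => psi_at h1 (T h2)) (comul h).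
have JE h : cowreath_psi (tlift (fun h1 h2 : E => h1 \ox T h2) (comul h)) = J h.
  rewrite /cowreath_psi tlift_comp; apply: eq_tlift => u v.
  exact: (tliftT _ _ (@psi_at_bilin K E A)).
pose i2 (h : E) : tens B E := (1 \ox h) \ox 1.
have i2l : linear i2 by move=> k u v; rewrite /i2 linearP tensorPl.
pose i2L := GRing.isLinear.Build K E (tens B E) _ i2 i2l.
pose iota2 : {linear E -> tens B E} := HB.pack i2 i2L.
have psiW h : psi_at 1 (rconv T h) = conv_along iota2 J h.
  pose Phi (u v w : E) : tens B E := psi_at v (T w) * ((1 \ox u) \ox 1).
  transitivity (tlift (fun h1 h2 : E =>
      tlift (fun u v => Phi u v h2) (comul h1)) (comul h)).
    rewrite /rconv psi_at_tlift.
    apply: eq_tlift => u v.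
    rewrite psi_at_mulr; apply: eq_tlift => u' v'.
    by rewrite mulr1.
  rewrite coassoc /Phi => [|v w k a b|u w k a b|u v k a b].
  - by rewrite /conv_along; apply: eq_tlift => u v; rewrite /J tlift_mul.
  - by rewrite linearP tensorPl mulPr.
  - by rewrite psi_atPl mulPl.
  by rewrite !linearP mulPl.
have W1 h : rconv T h \ox 1 = conv_along iota2 (fun h => T h \ox 1) h.
  rewrite /rconv tlift_tensl; apply: eq_tlift => u v.
  by rewrite tensorM mulr1.
split=> [I1 h | tw h].
  apply/(psi_at_twistP EnE mb rhoA); rewrite psiW W1 /conv_along; apply: eq_tlift => u v.
  by rewrite -JE I1.
rewrite JE; apply/eqP; rewrite -subr_eq0; apply/eqP.
pose N h := J h - T h \ox 1.
have Nl : linear N.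
  by move=> k u v; rewrite /N /J !linearP tensorPl scalerBr opprD addrACA.
pose NL := GRing.isLinear.Build K E (tens B E) _ N Nl.
pose N' : {linear E -> tens B E} := HB.pack N NL.
rewrite -[LHS]/(N' h); apply: (conv_along_inj EnE (iota := iota2)) => [u v||{}h].
- by rewrite /= /i2 !tensorM !mulr1.
- by [].
have /(psi_at_twistP EnE mb rhoA) := tw h; rewrite psiW W1 => /eqP.
rewrite -subr_eq0 => /eqP <-; rewrite [RHS]addrC -scaleN1r.
by apply: tlift_lin => u v /=; rewrite /N mulrBl addrC scaleN1r.
Qed.

End Integral.

(** * The second axiom on generators *)

Section Integral.
Variables (K : fieldType) (n : nat) (E : hopf_algebra K) (g : E) (x : 'I_n -> E).
Hypothesis EnE : is_En g x.
Variables (A : comodule_algebra E) (G : A) (X : 'I_n -> A).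
Hypotheses (mb : monomial_basis G X) (rhoA : canonical_coaction g x G X).
Local Notation Si := (@antipode_inv K E).
Local Notation B := (tens A E).
Variable T : {linear E -> B}.
Implicit Types (t : B).

(** One definition for each layer of the nested Sweedler sum, so that a generator is pushed through
    one coproduct at a time. *)
Definition int_lhs3 (a0 : A) (a1 h c : E) : B :=
  tlift (fun a2 a3 : E => (a0 \ox 1) * T (Si a2 * h * a1) * (1 \ox Si a3)) (comul c).
Definition int_lhs2 (a0 : A) (h b : E) : B :=
  tlift (fun a1 c : E => int_lhs3 a0 a1 h c) (comul b).
Definition int_lhs a h : B := tlift (fun (a0 : A) (b : E) => int_lhs2 a0 h b) (coact a).
Definition int_rhs a t : B :=
  tlift (fun (a0 : A) (a1 : E) => (1 \ox Si a1) * t * (a0 \ox 1)) (coact a).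

Let int_lhs3B (a0 : A) (a1 h : E) :
  bilin (fun a2 a3 : E => (a0 \ox 1) * T (Si a2 * h * a1) * (1 \ox Si a3)).
Proof.
split=> w k u v /=; last by rewrite !linearP mulPr.
by rewrite linearP !mulPl linearP mulPr mulPl.
Qed.

Let int_lhs2B a0 h : bilin (fun a1 c : E => int_lhs3 a0 a1 h c).
Proof.
split=> w; last by move=> k u v; rewrite /int_lhs3 !linearP.
apply: tlift_fun_linear => a2 a3 k u v.
by rewrite mulPr linearP mulPr mulPl.
Qed.

Let int_lhsB h : bilin (fun (a0 : A) (b : E) => int_lhs2 a0 h b).
Proof.
split=> w; last by move=> k u v; rewrite /int_lhs2 !linearP.
apply: tlift_fun_linear => a1 c; apply: tlift_fun_linear => a2 a3 k u v.
by rewrite tensorPl mulPl mulPl.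
Qed.

Let int_rhsB t : bilin (fun (a0 : A) (a1 : E) => (1 \ox Si a1) * t * (a0 \ox 1)).
Proof.
split=> w k u v /=; first by rewrite tensorPl mulPr.
by rewrite !linearP !mulPl.
Qed.

Lemma int_lhs3g a0 a1 h c : int_lhs3 a0 a1 h (g * c) = int_lhs3 a0 a1 (g * h) c * (1 \ox g).
Proof.
rewrite /int_lhs3 rmorphM /= (En_comulg EnE) (tlift_mull (int_lhs3B a0 a1 h)) tlift_mul.
apply: eq_tlift => u v.
by rewrite !(antipode_invM EnE) (antipode_invg EnE) !mulrA -[RHS]mulrA tensorM mul1r.
Qed.

Lemma int_lhs3x i a0 a1 h c : int_lhs3 a0 a1 h (x i * c) =
  int_lhs3 a0 a1 (x i * g * h) c * (1 \ox g) + int_lhs3 a0 a1 h c * (1 \ox (x i * g)).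
Proof.
rewrite /int_lhs3 rmorphM /= (En_comulx EnE) mulrDl linearD /=.
rewrite !(tlift_mull (int_lhs3B a0 a1 h)) !tlift_mul.
congr (_ + _); apply: eq_tlift => u v.
  rewrite !(antipode_invM EnE) (antipode_invg EnE) (antipode_invx EnE).
  by rewrite !mulrA -[RHS]mulrA tensorM mul1r.
by rewrite mul1r !(antipode_invM EnE) (antipode_invx EnE) -[RHS]mulrA tensorM mul1r.
Qed.

Lemma int_lhs2g a0 h b : int_lhs2 a0 h (g * b) = int_lhs2 a0 (g * h * g) b * (1 \ox g).
Proof.
rewrite /int_lhs2 rmorphM /= (En_comulg EnE) (tlift_mull (int_lhs2B a0 h)) tlift_mul.
apply: eq_tlift => u v; rewrite int_lhs3g /int_lhs3; congr (_ * _).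
by apply: eq_tlift => u' v'; rewrite !mulrA.
Qed.

Lemma int_lhs2x i a0 h b : int_lhs2 a0 h (x i * b) =
  int_lhs2 a0 (g * h * x i) b * (1 \ox g) + int_lhs2 a0 (x i * g * h) b * (1 \ox g)
  + int_lhs2 a0 h b * (1 \ox (x i * g)).
Proof.
rewrite /int_lhs2 rmorphM /= (En_comulx EnE) mulrDl linearD /=.
rewrite !(tlift_mull (int_lhs2B a0 h)) !tlift_mul -addrA.
congr (_ + _).
  apply: eq_tlift => u v; rewrite int_lhs3g /int_lhs3; congr (_ * _).
  by apply: eq_tlift => u' v'; rewrite !mulrA.
by apply: tliftD => u v; rewrite mul1r int_lhs3x.
Qed.

Lemma int_lhs2l u a0 h b : int_lhs2 (u * a0) h b = (u \ox 1) * int_lhs2 a0 h b.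
Proof.
rewrite /int_lhs2 mul_tlift; apply: eq_tlift => a1 c; rewrite /int_lhs3 mul_tlift.
by apply: eq_tlift => a2 a3; rewrite !mulrA tensorM mulr1.
Qed.

Lemma int_lhs_GM a h : int_lhs (G * a) h = (G \ox 1) * int_lhs a (g * h * g) * (1 \ox g).
Proof.
rewrite /int_lhs rmorphM /= (coactG rhoA) (tlift_mull (int_lhsB h)) mul_tlift tlift_mul.
by apply: eq_tlift => u v; rewrite int_lhs2l int_lhs2g mulrA.
Qed.

Let int_lhs_mulr a h c :
  int_lhs a h * c = tlift (fun (a0 : A) (b : E) => int_lhs2 a0 h b * c) (coact a).
Proof. exact: tlift_mul. Qed.

Let int_lhs_mull a h c d : c * int_lhs a h * d =
  tlift (fun (a0 : A) (b : E) => c * int_lhs2 a0 h b * d) (coact a).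
Proof. by rewrite -mulrA int_lhs_mulr mul_tlift; apply: eq_tlift => u v; rewrite mulrA. Qed.

Lemma int_lhs_XM i a h : int_lhs (X i * a) h =
  (X i \ox 1) * int_lhs a (g * h * g) * (1 \ox g) + int_lhs a (g * h * x i) * (1 \ox g)
  + int_lhs a (x i * g * h) * (1 \ox g) + int_lhs a h * (1 \ox (x i * g)).
Proof.
rewrite int_lhs_mull !int_lhs_mulr -!addrA.
transitivity (tlift (fun u v => int_lhs2 (X i * u) h (g * v) + int_lhs2 u h (x i * v)) (coact a)).
  rewrite /int_lhs rmorphM /= (coactX rhoA) mulrDl linearD /=.
  rewrite (tlift_mull (int_lhsB h) (X i)) (tlift_mull (int_lhsB h) 1).
  by symmetry; apply: tliftD => u v; rewrite mul1r.
do 3!rewrite -(tliftD _ (fun _ _ => erefl)).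
by apply: eq_tlift => u v; rewrite int_lhs2l int_lhs2g int_lhs2x mulrA !addrA.
Qed.

Lemma int_rhs_GM a t : int_rhs (G * a) t = int_rhs a ((1 \ox g) * t * (G \ox 1)).
Proof.
rewrite /int_rhs rmorphM /= (coactG rhoA) (tlift_mull (int_rhsB t)); apply: eq_tlift => u v.
rewrite (antipode_invM EnE) (antipode_invg EnE) !mulrA tensorM mul1r.
by rewrite -[RHS]mulrA tensorM mulr1.
Qed.

Lemma int_rhs_XM i a t : int_rhs (X i * a) t =
  int_rhs a ((1 \ox g) * t * (X i \ox 1) + (1 \ox (x i * g)) * t).
Proof.
rewrite /int_rhs rmorphM /= (coactX rhoA) mulrDl linearD /= !(tlift_mull (int_rhsB t)).
symmetry; apply: tliftD => u v; rewrite mulrDr mulrDl.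
rewrite !(antipode_invM EnE) (antipode_invg EnE) (antipode_invx EnE) !mulrA !tensorM !mul1r.
by rewrite !mulrA -[X in X + _ = _]mulrA tensorM mulr1.
Qed.

(** The outer factors from A on the left and from E on the right commute with the S^-1(a_1) and a_0
    surrounding t. This lets the induction in [integral2P] insert the equation for a generator under
    [int_rhs a]. *)
Lemma int_rhs_mul a u v t :
  int_rhs a ((u \ox 1) * t * (1 \ox v)) = (u \ox 1) * int_rhs a t * (1 \ox v).
Proof.
transitivity (tlift (fun (a0 : A) (a1 : E) =>
    (u \ox 1) * ((1 \ox Si a1) * t * (a0 \ox 1)) * (1 \ox v)) (coact a)); last first.
  by rewrite -tlift_mul -mul_tlift.
apply: eq_tlift => a0 a1.
by rewrite !mulrA tensC -!mulrA tensC.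
Qed.

Fact int_rhs_linear a : linear (int_rhs a).
Proof. by apply: tlift_fun_linear => u v k s t; rewrite mulPr mulPl. Qed.
HB.instance Definition _ a := GRing.isLinear.Build K B B _ (int_rhs a) (int_rhs_linear a).

Lemma int_lhs1 h : int_lhs 1 h = T h.
Proof.
rewrite /int_lhs (coact1 A) (tliftT _ _ (int_lhsB h)) /int_lhs2 (comul1 E) (tliftT _ _ (int_lhs2B 1 h)).
rewrite /int_lhs3 (comul1 E) (tliftT _ _ (int_lhs3B 1 1 h)) (antipode_inv1 EnE) mul1r mulr1.
by rewrite !tens1 mul1r mulr1.
Qed.

Lemma int_rhs1 t : int_rhs 1 t = t.
Proof.
by rewrite /int_rhs (coact1 A) (tliftT _ _ (int_rhsB t)) (antipode_inv1 EnE) !tens1 mul1r mulr1.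
Qed.

(* Both sides of the second integral axiom are compatible with products in a, *)
(* so it suffices to impose it on the generators G and X i.                    *)
Lemma integral2P :
  (forall a h, int_lhs a h = int_rhs a (T h)) <->
  (forall h, (G \ox 1) * T (g * h * g) * (1 \ox g) = (1 \ox g) * T h * (G \ox 1)) /\
  (forall i h, (X i \ox 1) * T (g * h * g) * (1 \ox g) + T (g * h * x i) * (1 \ox g)
     + T (x i * g * h) * (1 \ox g) + T h * (1 \ox (x i * g))
     = (1 \ox g) * T h * (X i \ox 1) + (1 \ox (x i * g)) * T h).
Proof.
split=> [I2 | [I2G I2X]].
  split=> [h | i h].
    by have := I2 (G * 1) h; rewrite int_lhs_GM int_rhs_GM int_lhs1 int_rhs1.
  by have := I2 (X i * 1) h; rewrite int_lhs_XM int_rhs_XM !int_lhs1 int_rhs1.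
move=> a; elim/(monomial_ind mb): a => [k a b IHa IHb h||a IH h|i a IH h].
- rewrite {1}/int_lhs {1}/int_rhs linearP !linearP /=.
  by rewrite -[tlift _ (coact a)]/(int_lhs a h) -[tlift _ (coact b)]/(int_lhs b h) IHa IHb.
- by move=> h; rewrite int_lhs1 int_rhs1.
- by rewrite int_lhs_GM int_rhs_GM IH -int_rhs_mul I2G.
rewrite int_lhs_XM int_rhs_XM !IH -I2X !linearD /= -int_rhs_mul.
have int_rhs_mulr v t : int_rhs a t * (1 \ox v) = int_rhs a (t * (1 \ox v)).
  by rewrite -[t]mul1r -tens1 int_rhs_mul tens1 !mul1r.
by rewrite !int_rhs_mulr.
Qed.

Lemma is_integralP :
  is_integral T <-> [/\ (forall h : E, rconv T h = twist (counit_r (rconv T h))),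
    (forall h : E, (G \ox 1) * T (g * h * g) * (1 \ox g)
      = (1 \ox g) * T h * (G \ox 1)) &
    (forall i (h : E),
      (X i \ox 1) * T (g * h * g) * (1 \ox g) + T (g * h * x i) * (1 \ox g)
      + T (x i * g * h) * (1 \ox g) + T h * (1 \ox (x i * g))
      = (1 \ox g) * T h * (X i \ox 1) + (1 \ox (x i * g)) * T h)].
Proof.
split=> [[/(integral1P EnE mb rhoA) I1 /integral2P[I2G I2X]] | [I1 I2G I2X]] //.
by split; [apply/(integral1P EnE mb rhoA) | apply/integral2P].
Qed.

End Integral.

(** * Expansions on monomials *)

Section EnMono.
Variables (K : fieldType) (n : nat) (E : hopf_algebra K) (g : E) (x : 'I_n -> E).
Hypothesis EnE : is_En g x.
Implicit Types (P Q F : {set 'I_n}) (i r : 'I_n).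
Local Notation "''x_' P" := (xprod x P) (at level 8, P at level 2).

Lemma En_gexp a b : odd a = odd b -> g ^+ a = g ^+ b.
Proof.
have gE m : g ^+ m = g ^+ odd m.
  rewrite -{1}[m]odd_double_half exprD -mul2n exprM expr2 (En_gg EnE) expr1n mulr1 //.
by move=> ab; rewrite gE ab -gE.
Qed.

Lemma En_xgexp i m : x i * g ^+ m = (-1) ^+ m *: (g ^+ m * x i).
Proof.
elim: m => [|m IH]; first by rewrite mulr1 mul1r scale1r.
rewrite exprSr mulrA IH -scalerAl -[in LHS]mulrA (En_xg EnE) mulrN scalerN mulrA.
by rewrite exprS mulN1r scaleNr.
Qed.

Lemma En_xxprod i F : x i * 'x_F = (-1) ^+ #|F| *: ('x_F * x i).
Proof.
elim/set_max_ind: F => [|F r Fr IH]; first by rewrite cards0 xprod0 mulr1 mul1r scale1r.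
rewrite cardsU1 above_notin // !xprodU1 // mulrA IH -scalerAl -[in LHS]mulrA (En_xC EnE).
by rewrite mulrN mulrA scalerN exprS mulN1r scaleNr.
Qed.

Lemma En_x_mono i m F :
  x i * (g ^+ m * 'x_F) = (-1) ^+ (m + #|F|) *: (g ^+ m * ('x_F * x i)).
Proof.
by rewrite mulrA En_xgexp -scalerAl -mulrA En_xxprod -scalerAr scalerA -exprD.
Qed.

Lemma En_xprodg m F : 'x_F * g ^+ m = (-1) ^+ (m * #|F|) *: (g ^+ m * 'x_F).
Proof.
elim/set_max_ind: F => [|F r Fr IH].
  by rewrite cards0 muln0 xprod0 mulr1 mul1r scale1r.
rewrite cardsU1 above_notin // !xprodU1 // -mulrA En_xgexp -scalerAr mulrA IH.
by rewrite -scalerAl scalerA -exprD mulnDr muln1 mulrA.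
Qed.

(** Each x_i contributes x_i (x) g or 1 (x) x_i, and F collects the indices of the second kind. In
    the second leg the exponent of g plus |F| has the parity of m + |P|: even and odd monomials span
    left coideals. *)
Lemma comul_mono m P : comul (g ^+ m * 'x_P) =
  \sum_(F : {set 'I_n} | F \subset P) (-1) ^+ (sexp F P + #|F| * #|P| + #|F|) *:
    ((g ^+ m * 'x_(P :\: F)) \ox (g ^+ (m + #|P| + #|F|) * 'x_F)).
Proof.
elim/set_max_ind: P => [|P r Pr IH].
  rewrite (eq_bigl (fun F => F == set0)) => [|F]; last by rewrite subset0.
  rewrite big_pred1_eq sexp0 cards0 !addn0 scale1r set0D xprod0 !mulr1.
  rewrite rmorphXn /= (En_comulg EnE); elim: m => [|m IH]; first by rewrite tens1.
  by rewrite exprS IH tensorM -!exprS.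
have rP := above_notin Pr.
rewrite xprodU1 // mulrA rmorphM /= IH (En_comulx EnE) mulr_suml sum_subsetU1 // -big_split.
apply: eq_bigr => F FP /=.
have Fr := aboveS FP Pr; have rF := above_notin Fr.
have PFr : above (P :\: F) r by apply: aboveS Pr; rewrite subsetDl.
rewrite setU1D // setU1DU1 // !xprodU1 // sexp_above // sexpU1_above //.
rewrite !cardsU1 rP rF mulrDr -!scalerAl !tensorM mulr1 -!mulrA.
have -> : 'x_F * g = (-1) ^+ #|F| *: (g * 'x_F) by rewrite -[g]expr1 En_xprodg mul1n.
rewrite -scalerAr linearZ /= scalerA -exprD mulrA [_ * (g * _)]mulrA -exprSr.
congr (_ *: (_ \ox (_ * _)) + _ *: (_ \ox (_ * _))).
- by apply: sign_eq; parity.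
- by apply: En_gexp; parity.
- by rewrite -(card_setDK FP); apply: sign_eq; parity.
by apply: En_gexp; parity.
Qed.

End EnMono.

Section Expansions.
Variables (K : fieldType) (n : nat) (E : hopf_algebra K) (g : E) (x : 'I_n -> E).
Hypothesis EnE : is_En g x.
Variables (A : comodule_algebra E) (G : A) (X : 'I_n -> A).
Hypotheses (rhoA : canonical_coaction g x G X).
Implicit Types (P Q F : {set 'I_n}) (i r : 'I_n).
Local Notation B := (tens A E).
Local Notation "''x_' P" := (xprod x P) (at level 8, P at level 2).
Local Notation "''X_' P" := (xprod X P) (at level 8, P at level 2).

Lemma rconv_sum (N : E -> B) m P : linear N -> rconv N (g ^+ m * 'x_P) =
  \sum_(F : {set 'I_n} | F \subset P) (-1) ^+ (sexp F P + #|F| * #|P| + #|F|) *: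
    (N (g ^+ (m + #|P| + #|F|) * 'x_F) * (1 \ox (g ^+ m * 'x_(P :\: F)))).
Proof.
move=> Nl; rewrite /rconv (comul_mono EnE) linear_sum; apply: eq_bigr => F FP.
rewrite linearZ /= tliftT //; split=> w k u v /=; first by rewrite linearP mulPr.
by rewrite Nl mulPl.
Qed.

(** The first legs carry g^|P|, which the extra factor cancels. What remains is the sum in condition
    (3) together with the summand F = P. *)
Lemma rconv_even (N : {linear E -> B}) P :
  rconv N (g ^+ #|P| * 'x_P) * (1 \ox g ^+ #|P|) =
  \sum_(F : {set 'I_n} | F \subset P) (-1) ^+ (sexp F P + #|P| + #|F|) *:
    (N (g ^+ #|F| * 'x_F) * (1 \ox 'x_(P :\: F))).
Proof.
rewrite rconv_sum; last exact: linearP.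
rewrite mulr_suml; apply: eq_bigr => F FP.
rewrite -scalerAl -mulrA tensorM mulr1 -mulrA (En_xprodg EnE) -scalerAr mulrA -exprD.
rewrite linearZ /= -scalerAr scalerA -exprD.
have -> : g ^+ (#|P| + #|P| + #|F|) = g ^+ #|F| by apply: (En_gexp EnE); parity.
have -> : g ^+ (#|P| + #|P|) = g ^+ 0 by apply: (En_gexp EnE); parity.
rewrite mul1r; congr (_ *: _); apply: sign_eq; rewrite -(card_setDK FP); parity.
Qed.

Lemma twist_Gexp m : twist (G ^+ m) = G ^+ m \ox g ^+ m.
Proof.
elim: m => [|m IH]; first exact: twist1 EnE A.
by rewrite exprS (twist_GM EnE rhoA) IH !tensorM mulr1 mul1r -exprSr.
Qed.

(** Factors are adjoined on the right by [twist_MX]; F collects those contributing S^-1(x_i) = x_i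
    g. These are the inner sums of conditions (1) and (3). *)
Lemma twist_mono k Q : twist (G ^+ k * 'X_Q) =
  \sum_(F : {set 'I_n} | F \subset Q) (-1) ^+ (sexp (Q :\: F) Q + (#|Q| + k) * #|F|) *:
    ((G ^+ k * 'X_(Q :\: F)) \ox (g ^+ (#|Q| + k) * 'x_F)).
Proof.
elim/set_max_ind: Q => [|P r Pr IH].
  rewrite (eq_bigl (fun F => F == set0)) => [|F]; last by rewrite subset0.
  rewrite big_pred1_eq set0D sexp0 cards0 muln0 scale1r !xprod0 !mulr1.
  exact: twist_Gexp.
have rP := above_notin Pr.
rewrite xprodU1 // mulrA (twist_MX EnE rhoA) IH mulr_sumr mulr_suml mulr_sumr.
rewrite sum_subsetU1 //; congr (_ + _); apply: eq_bigr => F FP;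
  have Fr := aboveS FP Pr; have rF := above_notin Fr.
  have PFr : above (P :\: F) r by apply: aboveS Pr; rewrite subsetDl.
  rewrite setU1D // sexpU1_above ?subsetDl // xprodU1 // cardsU1 rP.
  rewrite -scalerAr -scalerAl !tensorM mul1r mulr1 !mulrA -exprS.
  by congr (_ *: _); apply: sign_eq; rewrite setDDr setDv set0U (setIidPr FP); parity.
rewrite setU1DU1 // sexp_above ?subsetDl // xprodU1 // !cardsU1 rP rF.
rewrite -scalerAr tensorM mul1r -mulrA [g * (_ * _)]mulrA -exprS (En_x_mono EnE).
rewrite linearZ /= scalerA -exprD -addSn -[(#|P|.+1)]add1n.
by congr (_ *: _); apply: sign_eq; parity.
Qed.

End Expansions.

Lemma vect_eq (K : fieldType) (V : vectType K) (u v : V) :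
  (forall i, coord (vbasis {:V}) i u = coord (vbasis {:V}) i v) -> u = v.
Proof.
move=> uv; rewrite (coord_vbasis (memvf u)) (coord_vbasis (memvf v)).
by apply: eq_bigr => i _; rewrite uv.
Qed.

(* ring needs a commutative carrier; a linear identity between vectors is      *)
(* therefore checked on each coordinate.                                       *)
Ltac abel := apply: vect_eq => ?; rewrite ?(linearD, linearN, linear0, scalarZ) /=; ring.

Lemma linear_add (K : fieldType) (V W : lmodType K) (f f' : V -> W) :
  linear f -> linear f' -> linear (fun u => f u + f' u).
Proof. by move=> fl fl' k u v; rewrite fl fl' scalerDr addrACA. Qed.

(** * The integral axioms in terms of phi *)

Section Generators.
Variables (K : fieldType) (n : nat) (E : hopf_algebra K) (g : E) (x : 'I_n -> E).
Hypothesis EnE : is_En g x.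
Variables (A : comodule_algebra E) (G : A) (X : 'I_n -> A).
Hypotheses (mb : monomial_basis G X) (rhoA : canonical_coaction g x G X).
Variable T : {linear E -> tens A E}.
Local Notation B := (tens A E).
Local Notation w := (rconv T).
Implicit Types (h : E) (b : A).

Definition lhsG h : B := (G \ox 1) * T (g * h * g) * (1 \ox g).
Definition rhsG h : B := (1 \ox g) * T h * (G \ox 1).
Definition lhsX i h : B :=
  (X i \ox 1) * T (g * h * g) * (1 \ox g) + T (g * h * x i) * (1 \ox g)
  + T (x i * g * h) * (1 \ox g) + T h * (1 \ox (x i * g)).
Definition rhsX i h : B := (1 \ox g) * T h * (X i \ox 1) + (1 \ox (x i * g)) * T h.

Lemma lhsG_linear : linear lhsG.
Proof. by move=> k u v; rewrite /lhsG mulPr mulPl linearP mulPr mulPl. Qed.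
Lemma rhsG_linear : linear rhsG.
Proof. by move=> k u v; rewrite /rhsG linearP mulPr mulPl. Qed.
Lemma lhsX_linear i : linear (lhsX i).
Proof.
apply: linear_add; [apply: linear_add; [apply: linear_add|]|]; move=> k u v.
- by rewrite mulPr mulPl linearP mulPr mulPl.
- by rewrite mulPr mulPl linearP mulPl.
- by rewrite mulPr linearP mulPl.
by rewrite linearP mulPl.
Qed.
Lemma rhsX_linear i : linear (rhsX i).
Proof.
apply: linear_add; move=> k u v; first by rewrite linearP mulPr mulPl.
by rewrite linearP mulPr.
Qed.

Let wB : bilin (fun h1 h2 : E => T h2 * (1 \ox h1)).
Proof. by split=> c k u v /=; rewrite ?linearP ?mulPr ?mulPl. Qed.

Lemma rconv_add (N N' : E -> B) h :
  rconv (fun h => N h + N' h) h = rconv N h + rconv N' h.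
Proof. by apply: tliftD => u v; rewrite mulrDl. Qed.

Lemma rconv_conj h : w (g * h * g) =
  tlift (fun h1 h2 : E => T (g * h2 * g) * (1 \ox (g * h1 * g))) (comul h).
Proof.
rewrite /rconv !rmorphM /= (En_comulg EnE) -mulrA (tlift_mull wB) tlift_mulr.
  by apply: eq_tlift => u v; rewrite !mulrA.
by split=> c k u v /=; rewrite !mulPr ?linearP ?mulPr ?mulPl.
Qed.

Lemma rconv_conjl b h :
  rconv (fun h => (b \ox 1) * T (g * h * g) * (1 \ox g)) h
  = (b \ox 1) * w (g * h * g) * (1 \ox g).
Proof.
rewrite rconv_conj mul_tlift tlift_mul; apply: eq_tlift => u v.
by rewrite -!mulrA !tensorM !mulr1 -!mulrA (En_gg EnE) mulr1.
Qed.

Lemma rconv_mid c b h :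
  rconv (fun h => (1 \ox c) * T h * (b \ox 1)) h = (1 \ox c) * w h * (b \ox 1).
Proof.
rewrite /rconv mul_tlift tlift_mul; apply: eq_tlift => u v.
by rewrite -!mulrA tensC.
Qed.

(** The coproduct of x_i adds to the wanted term of w(g h x_i) the term T(g h_2 g)(1 (x) g h_1 x_i),
    which equals w(ghg)(1 (x) g x_i). *)
Lemma rconv_ghx i h : rconv (fun h => T (g * h * x i) * (1 \ox g)) h
  = w (g * h * x i) - w (g * h * g) * (1 \ox (g * x i)).
Proof.
have bT : bilin (fun u v : E => T (g * v) * (1 \ox (g * u))).
  by split=> c k u v /=; rewrite mulPr ?linearP ?mulPr ?mulPl.
apply/(canRL (addrK _)); rewrite rconv_conj tlift_mul.
rewrite {2}/rconv !rmorphM /= (En_comulg EnE) (En_comulx EnE) -mulrA (tlift_mull wB).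
rewrite mulrDr linearD /= !(tlift_mulr bT) addrC.
congr (_ + _); apply: eq_tlift => u v.
  rewrite !mulrA -[LHS]mulrA tensorM mulr1 mulrA -[_ * g * g]mulrA (En_gg EnE) !mulr1.
  by [].
by rewrite mulr1 !mulrA -mulrA tensorM mulr1.
Qed.

Lemma rconv_xgh i h :
  rconv (fun h => T (x i * g * h) * (1 \ox g) + T h * (1 \ox (x i * g))) h
  = w (x i * g * h).
Proof.
rewrite /rconv !rmorphM /= (En_comulg EnE) (En_comulx EnE) mulrDl !tensorM mulrDl linearD /=.
rewrite !(tlift_mull wB) (En_gg EnE) !mul1r addrC; apply: tliftD => u v.
by rewrite mul1r mulrDl -!mulrA !tensorM !mulr1 !mulrA.
Qed.

Lemma rconv_lhsX i h : rconv (lhsX i) h = (X i \ox 1) * w (g * h * g) * (1 \ox g)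
  + (w (g * h * x i) - w (g * h * g) * (1 \ox (g * x i))) + w (x i * g * h).
Proof.
rewrite -rconv_conjl -rconv_ghx -rconv_xgh -!rconv_add.
by apply: eq_tlift => u v; rewrite addrA.
Qed.

Lemma rconv_rhsX i h :
  rconv (rhsX i) h = (1 \ox g) * w h * (X i \ox 1) + (1 \ox (x i * g)) * w h.
Proof.
have e : (1 \ox (x i * g)) * w h = (1 \ox (x i * g)) * w h * (1 \ox 1) by rewrite tens1 mulr1.
rewrite e -!rconv_mid -rconv_add; apply: eq_tlift => u v.
by rewrite /rhsX tens1 mulr1.
Qed.

End Generators.

Section Conditions.
Variables (K : fieldType) (n : nat) (E : hopf_algebra K) (g : E) (x : 'I_n -> E).
Hypothesis EnE : is_En g x.
Variables (A : comodule_algebra E) (G : A) (X : 'I_n -> A).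
Hypotheses (mb : monomial_basis G X) (rhoA : canonical_coaction g x G X).
Variable T : {linear E -> tens A E}.
Local Notation B := (tens A E).
Local Notation w := (rconv T).
Implicit Types (h : E) (b : A).

Local Notation lhsG := (lhsG g G T).
Local Notation rhsG := (rhsG g G T).
Local Notation lhsX := (lhsX g x X T).
Local Notation rhsX := (rhsX g x X T).
Local Notation phi h := (counit_r (w h)).
Local Notation "''x_' P" := (xprod x P) (at level 8, P at level 2).

Lemma twist_inj : injective (@twist K E A).
Proof. exact: can_inj (twistK EnE mb rhoA). Qed.

Lemma rconv_twistG b b' h : w (g * h * g) = twist b' -> w h = twist b ->
  rconv lhsG h = rconv rhsG h <-> G * b' = b * G.
Proof.
move=> eb' eb; rewrite /lhsG /rhsG (rconv_conjl EnE) rconv_mid eb eb'.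
rewrite -(twist_GM EnE rhoA) -(twist_MG EnE rhoA).
by split=> [/twist_inj|->].
Qed.

(** As g x_i = - x_i g, the correction term of [rconv_lhsX] is the second half of twist(X_i b'). The
    lemma concerns a single h because [rconv_step] uses it before w is known to be twisted
    everywhere. *)
Lemma rconv_twistX i b b' h : w (g * h * g) = twist b' -> w h = twist b ->
  rconv (lhsX i) h = rconv (rhsX i) h <->
  w (g * h * x i) + w (x i * g * h) = twist (b * X i - X i * b').
Proof.
move=> eb' eb; rewrite (rconv_lhsX EnE) rconv_rhsX eb eb'.
rewrite linearB /= (twist_XM EnE rhoA) -(twist_MX EnE rhoA) (En_xg EnE).
rewrite linearN mulrN.
move: (_ * twist b' * _) (twist b' * _) (twist (b * _)) (w _) (w _) => s t u v v'.
by split=> [<-|e]; [abel | rewrite -[RHS](subrK (s - t)) -e; abel].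
Qed.

Hypothesis I1 : forall h, w h = twist (phi h).

Lemma integralG :
  (forall h, lhsG h = rhsG h) <-> (forall h, G * phi (g * h * g) = phi h * G).
Proof.
split=> [I h | I].
  by apply/(rconv_twistG (I1 _) (I1 _)); apply: eq_tlift => u v; rewrite I.
apply: (rconv_inj EnE (lhsG_linear _ _ _) (rhsG_linear _ _ _)) => h.
exact/(rconv_twistG (I1 _) (I1 _)).
Qed.

Lemma integralX i :
  (forall h, lhsX i h = rhsX i h) <->
  (forall h, phi (g * h * x i) + phi (x i * g * h) = phi h * X i - X i * phi (g * h * g)).
Proof.
have key h : rconv (lhsX i) h = rconv (rhsX i) h <->
    phi (g * h * x i) + phi (x i * g * h) = phi h * X i - X i * phi (g * h * g).
  split=> [/(rconv_twistX i (I1 _) (I1 _)) e|e].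
    by apply: twist_inj; rewrite -e linearD /= -!I1.
  by apply/(rconv_twistX i (I1 _) (I1 _)); rewrite -e linearD /= -!I1.
split=> [I h | I].
  by apply/key; apply: eq_tlift => u v; rewrite I.
apply: (rconv_inj EnE (lhsX_linear _ _ _ _ _) (rhsX_linear _ _ _ _ _)) => h.
exact/key.
Qed.

End Conditions.

(** * Conditions (1)-(3) *)

Section Translate.
Variables (K : fieldType) (n : nat) (E : hopf_algebra K) (g : E) (x : 'I_n -> E).
Hypothesis EnE : is_En g x.
Variables (alpha : K) (beta gamma : 'I_n -> K) (lambda : 'I_n -> 'I_n -> K).
Variables (A : comodule_algebra E) (G : A) (X : 'I_n -> A).
Hypothesis ClA : is_clifford alpha beta gamma lambda G X.
Hypothesis rhoA : canonical_coaction g x G X.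
Variable T : {linear E -> tens A E}.
Local Notation B := (tens A E).
Local Notation w := (rconv T).
Local Notation "''x_' P" := (xprod x P) (at level 8, P at level 2).
Local Notation "''X_' P" := (xprod X P) (at level 8, P at level 2).
Implicit Types (P Q F : {set 'I_n}) (i r : 'I_n) (a : A).

Let rel : clifford_rel alpha beta gamma lambda G X := (clifford_presented ClA).1.
Let mb : monomial_basis G X := clifford_basis ClA.

Lemma twist_cl_elt eta m : twist (cl_elt G X eta) * (1 \ox g ^+ m) =
  \sum_(k : bool) \sum_(Q : {set 'I_n}) \sum_(F : {set 'I_n} | F \subset Q)
    ((-1) ^+ (sexp (Q :\: F) Q + (#|Q| + k + m) * #|F|) * eta k Q) *:
      ((G ^+ k * 'X_(Q :\: F)) \ox (g ^+ (#|Q| + k + m) * 'x_F)).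
Proof.
rewrite -cl_eltE linear_sum mulr_suml; apply: eq_bigr => k _.
rewrite linear_sum mulr_suml; apply: eq_bigr => Q _.
rewrite linearZ /= (twist_mono EnE rhoA) scaler_sumr mulr_suml; apply: eq_bigr => F _.
rewrite -!scalerAl tensorM mulr1 -mulrA (En_xprodg EnE) -scalerAr !scalerA.
rewrite [_ * (g ^+ m * _)]mulrA -exprD. 
by rewrite linearZ /= scalerA -mulrA -exprD -addnA -mulnDl mulrC.
Qed.

Lemma mulg_inj m : injective (fun t : B => t * (1 \ox g ^+ m)).
Proof.
apply: (can_inj (g := fun t : B => t * (1 \ox g ^+ m))) => t.
rewrite -mulrA tensorM mulr1 -exprD (@En_gexp _ _ _ _ _ EnE _ 0); last by parity.
by rewrite tens1 mulr1.
Qed.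

(** Since g is grouplike, T(g) = w(g)(1 (x) g); the mu are the coordinates of a, and their equations
    are [comm_GP] with trivial sign. *)
Lemma condition1P :
  condition1 g x alpha gamma G X T <-> exists a, w g = twist a /\ G * a = a * G.
Proof.
have wg : w g = T g * (1 \ox g ^+ 1).
  rewrite /rconv (En_comulg EnE) tliftT ?expr1 //.
  by split=> c k u v /=; rewrite ?linearP ?mulPr ?mulPl.
have muP mu : mu_conditions alpha gamma mu <-> G * cl_elt G X mu = cl_elt G X mu * G.
  have := comm_GP rel mb 0 mu; rewrite expr0 scale1r => H.
  split=> [m | /H m P].
    apply/H => Q []; have [m0 m1] := m Q; rewrite ?expr1 ?expr0 ?mulr1 //.
    by rewrite -m1 -!mulrA [alpha * _]mulrC.
  by have := m P false; have := m P true; rewrite expr1 expr0 mulr1 /= => <- <-;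
    rewrite -!mulrA [alpha * _]mulrC.
have TE mu : (T g = \sum_(j : bool) \sum_(P : {set 'I_n}) \sum_(F : {set 'I_n} | F \subset P)
            ((-1) ^+ (sexp (P :\: F) P + (j + #|P| + 1) * #|F|) * mu j P) *:
              ((G ^+ j * 'X_(P :\: F)) \ox (g ^+ (j + #|P| + 1) * 'x_F)))
    <-> w g = twist (cl_elt G X mu).
  rewrite wg; under eq_bigr => j _ do under eq_bigr => P _ do rewrite [(j + _)%N]addnC.
  rewrite -twist_cl_elt; split=> [->|e]; last first.
    apply: (@mulg_inj 1); rewrite e -mulrA tensorM mulr1 -exprD.
    by rewrite expr2 (En_gg EnE) tens1 mulr1.
  by rewrite -mulrA tensorM mulr1 -exprD expr2 (En_gg EnE) tens1 mulr1.
split=> [[mu [/TE e /muP c]] | [a [e c]]]; first by exists (cl_elt G X mu).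
have [mu am] := cl_elt_onto mb a; rewrite am in e c.
by exists mu; split; [apply/TE | apply/muP].
Qed.

(** U_P is twist(a)(1 (x) g^|P|) for the a with coordinates eta, and the formula for T is
    [rconv_even] solved for the summand F = P. *)
Lemma condition3P :
  condition3 g x alpha beta gamma lambda G X T <->
  forall P, exists a, [/\ w (g ^+ #|P| * 'x_P) = twist a,
    (-1) ^+ #|P| *: (G * a) = a * G & forall i, (-1) ^+ #|P| *: (X i * a) = a * X i].
Proof.
have etaP P eta : eta_conditions alpha beta gamma lambda P eta <->
    (-1) ^+ #|P| *: (G * cl_elt G X eta) = cl_elt G X eta * G /\
    forall i, (-1) ^+ #|P| *: (X i * cl_elt G X eta) = cl_elt G X eta * X i.
  split=> [[a b] | [/(comm_GP rel mb) a b]].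
    by split=> [|i]; [apply/(comm_GP rel mb) | apply/(comm_XP rel mb) => Q; apply: b].
  by split=> // i Q; move: (b i) => /(comm_XP rel mb); apply.
have TE P eta : T (g ^+ #|P| * 'x_P) =
      \sum_(F : {set 'I_n} | F \proper P)
        (-1) ^+ (sexp F P + #|P| + #|F| + 1) *:
          (T (g ^+ #|F| * 'x_F) * (1 \ox 'x_(P :\: F)))
      + U_term g x G X P eta <-> w (g ^+ #|P| * 'x_P) = twist (cl_elt G X eta).
  have -> : U_term g x G X P eta = twist (cl_elt G X eta) * (1 \ox g ^+ #|P|).
    rewrite twist_cl_elt; apply: eq_bigr => k _; apply: eq_bigr => Q _.
    apply: eq_bigr => F _; rewrite mulrC.
    by have -> : (#|P| + #|Q| + k = #|Q| + k + #|P|)%N by lia.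
  have := rconv_even EnE T P; rewrite (bigD1 P) //= => eT.
  have sPP : sexp P P = 0%N.
    rewrite sexpE // setDv /ninv big1 // => i _; rewrite -(cards0 'I_n).
    by apply: eq_card => l; rewrite !inE.
  have e0 : (-1) ^+ (sexp P P + #|P| + #|P|) *:
      (T (g ^+ #|P| * 'x_P) * (1 \ox 'x_(P :\: P))) = T (g ^+ #|P| * 'x_P).
    rewrite sPP setDv xprod0 tens1 mulr1 (@sign_eq _ _ 0) ?scale1r //.
    by parity.
  rewrite e0 in eT.
  have -> : \sum_(F : {set 'I_n} | F \proper P)
        (-1) ^+ (sexp F P + #|P| + #|F| + 1) *:
          (T (g ^+ #|F| * 'x_F) * (1 \ox 'x_(P :\: F)))
      = - \sum_(F : {set 'I_n} | (F \subset P) && (F != P)) (-1) ^+ (sexp F P + #|P| + #|F|) *: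
          (T (g ^+ #|F| * 'x_F) * (1 \ox 'x_(P :\: F))).
    rewrite -sumrN; apply: eq_big => [F|F _]; first by rewrite properEneq andbC.
    by rewrite exprD expr1 mulrN1 scaleNr.
  split=> [e | e].
    by apply: (@mulg_inj #|P|); rewrite /= eT e addrC addrA subrr add0r.
  by rewrite -e eT addrCA addNr addr0.
split=> H P.
  have [eta [/TE e /etaP[c d]]] := H P.
  by exists (cl_elt G X eta).
have [a [e c d]] := H P; have [eta aE] := cl_elt_onto mb a; rewrite aE in e c d.
by exists eta; split; [apply/TE | apply/etaP].
Qed.

End Translate.

(** * Even and odd monomials *)

Section Main.
Variables (K : fieldType) (n : nat) (E : hopf_algebra K) (g : E) (x : 'I_n -> E).
Hypothesis EnE : is_En g x.
Variables (alpha : K) (beta gamma : 'I_n -> K) (lambda : 'I_n -> 'I_n -> K).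
Variables (A : comodule_algebra E) (G : A) (X : 'I_n -> A).
Hypothesis ClA : is_clifford alpha beta gamma lambda G X.
Hypothesis rhoA : canonical_coaction g x G X.
Variable T : {linear E -> tens A E}.
Local Notation B := (tens A E).
Local Notation w := (rconv T).
Local Notation "''x_' P" := (xprod x P) (at level 8, P at level 2).
Local Notation "''X_' P" := (xprod X P) (at level 8, P at level 2).
Implicit Types (P Q F : {set 'I_n}) (i r : 'I_n) (a : A).

Let rel : clifford_rel alpha beta gamma lambda G X := (clifford_presented ClA).1.
Let mb : monomial_basis G X := clifford_basis ClA.

Local Notation lhsG := (lhsG g G T).
Local Notation rhsG := (rhsG g G T).
Local Notation lhsX := (lhsX g x X T).
Local Notation rhsX := (rhsX g x X T).

Lemma conj_mono m P : g * (g ^+ m * 'x_P) * g = (-1) ^+ #|P| *: (g ^+ m * 'x_P).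
Proof.
have := En_xprodg EnE 1 P; rewrite expr1 mul1n => xg.
rewrite -!mulrA xg -!scalerAr !mulrA -exprS -exprSr; congr (_ *: (_ * _)).
by apply: (En_gexp EnE); parity.
Qed.

Lemma mono_x m P r : g * (g ^+ m * 'x_P) * x r = g ^+ m.+1 * ('x_P * x r).
Proof. by rewrite exprS !mulrA. Qed.

(** The sign is -1 for m = |P| and +1 for m = |P| + 1: compared with [mono_x], the two middle terms
    of the X-equation cancel on even monomials and coincide on odd ones. *)
Lemma x_mono m P r :
  x r * g * (g ^+ m * 'x_P) = (-1) ^+ (m.+1 + #|P|) *: (g ^+ m.+1 * ('x_P * x r)).
Proof. by rewrite -(En_x_mono EnE) exprS !mulrA. Qed.

Lemma En_ext (W : lmodType K) (f f' : E -> W) : linear f -> linear f' ->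
  (forall P, f (g ^+ #|P| * 'x_P) = f' (g ^+ #|P| * 'x_P)) ->
  (forall P, f (g ^+ #|P|.+1 * 'x_P) = f' (g ^+ #|P|.+1 * 'x_P)) -> f =1 f'.
Proof.
move=> fl fl' e0 e1 h.
pose F1 := GRing.isLinear.Build K E W _ f fl.
pose F2 := GRing.isLinear.Build K E W _ f' fl'.
pose f1 : {linear E -> W} := HB.pack f F1.
pose f2 : {linear E -> W} := HB.pack f' F2.
rewrite -[LHS]/(f1 h) -[RHS]/(f2 h).
have [c ->] := codom_basis_expand (En_basis EnE) h.
rewrite !linear_sum; apply: eq_bigr => -[k P] _; rewrite !linearZ /=; congr (_ *: _).
have [e|e] : odd k = odd #|P| \/ odd k = odd #|P|.+1.
- by rewrite /=; case: (odd k); case: (odd _); [left|right|right|left].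
- by rewrite (En_gexp EnE e) e0.
by rewrite (En_gexp EnE e) e1.
Qed.

Hypothesis two_neq0 : (2 : K) != 0.

Lemma half_eq (V : vectType K) (a b c d t : V) :
  d + t + t + c = a - b <-> t = 2^-1 *: (a - b - c - d).
Proof.
split=> [<-|->]; apply: vect_eq => i;
  rewrite ?(linearD, linearN, scalarZ) /=; by field.
Qed.

(** On odd h both middle terms involve the same value T(g^|P| x_P x_r); after multiplication by 1
    (x) g, [half_eq] solves the X-equation for it. *)
Lemma condition2P : condition2 g x X T <->
  forall P r, above P r -> lhsX r (g ^+ #|P|.+1 * 'x_P) = rhsX r (g ^+ #|P|.+1 * 'x_P).
Proof.
have key P r : T (g ^+ #|P| * 'x_P * x r) =
      2^-1 *: ((1 \ox g) * T (g ^+ (#|P| + 1) * 'x_P) * (X r \ox g)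
               - (1 \ox (g * x r)) * T (g ^+ (#|P| + 1) * 'x_P) * (1 \ox g)
               - T (g ^+ (#|P| + 1) * 'x_P) * (1 \ox x r)
               + (-1) ^+ (#|P| + 1) *: ((X r \ox 1) * T (g ^+ (#|P| + 1) * 'x_P)))
    <-> lhsX r (g ^+ #|P|.+1 * 'x_P) = rhsX r (g ^+ #|P|.+1 * 'x_P).
  rewrite addn1 [(-1) ^+ _]exprS mulN1r scaleNr -half_eq.
  set h := g ^+ #|P|.+1 * 'x_P.
  have e : g ^+ #|P|.+2 * ('x_P * x r) = g ^+ #|P| * 'x_P * x r.
    by rewrite mulrA; congr (_ * _ * _); apply: (En_gexp EnE); parity.
  have le : lhsX r h * (1 \ox g ^+ 1) = (-1) ^+ #|P| *: ((X r \ox 1) * T h)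
      + T (g ^+ #|P| * 'x_P * x r) + T (g ^+ #|P| * 'x_P * x r) + T h * (1 \ox x r).
    rewrite /lhsX /h conj_mono mono_x x_mono e -/h !linearZ /= expr1.
    rewrite (@sign_eq _ (#|P|.+2 + #|P|) 0); last by parity.
    rewrite scale1r !mulrDl -!mulrA !tensorM !mulr1 (En_gg EnE) tens1 !mulr1.
    by rewrite -mulrA (En_gg EnE) mulr1 -scalerAr.
  have re : rhsX r h * (1 \ox g ^+ 1) =
      (1 \ox g) * T h * (X r \ox g) - (1 \ox (g * x r)) * T h * (1 \ox g).
    rewrite /rhsX mulrDl expr1 -[_ * (X r \ox 1) * _]mulrA tensorM mulr1 mul1r.
    by rewrite (En_xg EnE) linearN /= mulNr mulNr.
  rewrite -le -re; split=> [/(mulg_inj EnE)//|->//].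
by split=> H P r Pr; apply/key; apply: H.
Qed.

Local Notation phi h := (counit_r (w h)).

Lemma rconv_conj_mono m P : w (g * (g ^+ m * 'x_P) * g) = (-1) ^+ #|P| *: w (g ^+ m * 'x_P).
Proof. by rewrite conj_mono linearZ. Qed.

Lemma En_xprodMx P r :
  'x_P * x r = ((-1) ^+ #|[set m in P | (r < m)%N]| * (r \notin P)%:R) *: 'x_(r |: P).
Proof.
have [[[gg xx gx xC] _] _ _ _ _ _ _ _ _] := EnE.
(* E(n) is itself a Clifford algebra, with all scalars but alpha = 1 zero. *)
have relE : clifford_rel 1 (fun=> 0) (fun=> 0) (fun _ _ => 0) g x.
  split=> [|i|i|i j ij]; rewrite ?scale1r ?scale0r //; first by rewrite gx addNr.
  by rewrite xC // addNr.
rewrite (xprodMX relE) big1 ?add0r => [|l _]; last first.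
  by rewrite /lam if_same mulr0 scale0r.
rewrite /toggle /toggle_coef; case: (r \in P) => //=.
by rewrite mulr0 !scale0r.
Qed.

(** A graded Jacobi identity, with e the parity sign of u and with y, z odd: [[u,z],y] + [[u,y],z] =
    [u, yz + zy], which vanishes because yz + zy is scalar. *)
Lemma half_supercomm_swap (u y z : A) (e l : K) : e * e = 1 -> y * z + z * y = l%:A ->
  - (2^-1 *: ((2^-1 *: (u * z - e *: (z * u))) * y + e *: (y * (2^-1 *: (u * z - e *: (z * u))))))
  = 2^-1 *: ((2^-1 *: (u * y - e *: (y * u))) * z + e *: (z * (2^-1 *: (u * y - e *: (y * u))))).
Proof.
move=> ee /(canRL (addrK _)) yz.
have e1 : u * y * z = l *: u - u * z * y.
  by rewrite -mulrA yz mulrBr -scalerAr mulr1 mulrA.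
have e2 : y * z * u = l *: u - z * y * u.
  by rewrite yz mulrBl -scalerAl mul1r.
rewrite -!scalerAl -!scalerAr !(mulrBl, mulrBr) -!scalerAl -!scalerAr !mulrA e1 e2.
apply: vect_eq => i; rewrite ?(linearD, linearN, scalarZ) /=.
have: (e == 1) || (e == -1) by rewrite -sqrf_eq1 expr2 ee.
by case/orP=> /eqP ->; ring.
Qed.

(** The iterated supercommutator is u y^2 - y^2 u. *)
Lemma half_supercomm_sqr (u y : A) (e l : K) : e * e = 1 -> y * y = l%:A ->
  2^-1 *: ((2^-1 *: (u * y - e *: (y * u))) * y + e *: (y * (2^-1 *: (u * y - e *: (y * u))))) = 0.
Proof.
move=> ee yy.
have e1 : u * y * y = l *: u by rewrite -mulrA yy -scalerAr mulr1.
have e2 : y * y * u = l *: u by rewrite yy -scalerAl mul1r.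
rewrite -!scalerAl -!scalerAr !(mulrBl, mulrBr) -!scalerAl -!scalerAr !mulrA e1 e2.
apply: vect_eq => i; rewrite ?(linearD, linearN, linear0, scalarZ) /=.
have: (e == 1) || (e == -1) by rewrite -sqrf_eq1 expr2 ee.
by case/orP=> /eqP ->; ring.
Qed.

(** By the same Jacobi identity, [u,y] = 0 forces [[u,z],y] = 0. Applied with y = G and z = X_r. *)
Lemma half_supercomm_comm (u y z : A) (e l : K) : e * e = 1 -> y * z + z * y = l%:A ->
  e *: (y * u) = u * y ->
  - e *: (y * (2^-1 *: (u * z - e *: (z * u)))) = (2^-1 *: (u * z - e *: (z * u))) * y.
Proof.
move=> ee /(canRL (addrK _)) yz yu.
have yu' : y * u = e *: (u * y) by rewrite -yu scalerA ee scale1r.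
have e1 : u * y * z = l *: u - u * z * y.
  by rewrite -mulrA yz mulrBr -scalerAr mulr1 mulrA.
have e2 : z * u * y = e *: (l *: u) - e *: (y * z * u).
  by rewrite -mulrA -yu -scalerAr mulrA yz mulrBl -scalerAl mul1r scalerBr; abel.
rewrite -!scalerAl -!scalerAr !(mulrBl, mulrBr) -!scalerAl -!scalerAr !mulrA yu' -scalerAl e1 e2.
apply: vect_eq => i; rewrite ?(linearD, linearN, linear0, scalarZ) /=.
have: (e == 1) || (e == -1) by rewrite -sqrf_eq1 expr2 ee.
by case/orP=> /eqP ->; ring.
Qed.

(** * Sufficiency of the conditions *)

Section Sufficiency.
Hypothesis Tg : w g = twist (phi g).
Hypothesis TX :
  forall P r, above P r -> lhsX r (g ^+ #|P|.+1 * 'x_P) = rhsX r (g ^+ #|P|.+1 * 'x_P).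

Let c P := phi (g ^+ #|P|.+1 * 'x_P).

(** The convolution at an odd monomial involves only odd monomials on subsets F of P, and r is above
    each such F. *)
Lemma rconv_lhsX_rhsX P r : above P r ->
  rconv (lhsX r) (g ^+ #|P|.+1 * 'x_P) = rconv (rhsX r) (g ^+ #|P|.+1 * 'x_P).
Proof.
move=> Pr; rewrite !(rconv_sum EnE); last exact: lhsX_linear; last exact: rhsX_linear.
apply: eq_bigr => F FP; congr (_ *: (_ * _)).
have -> : g ^+ (#|P|.+1 + #|P| + #|F|) = g ^+ #|F|.+1 by apply: (En_gexp EnE); parity.
exact/TX/(aboveS FP).
Qed.

(** The two middle terms agree, so twice the left side is a twisted element; thus the form w = twist
    phi passes from P to r |: P. *)
Lemma rconv_step P r : above P r ->
  w (g ^+ #|P|.+1 * 'x_P) = twist (c P) ->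
  w (g ^+ #|P|.+2 * ('x_P * x r)) = twist (2^-1 *: (c P * X r - (-1) ^+ #|P| *: (X r * c P))).
Proof.
move=> Pr wP; have := rconv_lhsX_rhsX Pr.
have wP' : w (g * (g ^+ #|P|.+1 * 'x_P) * g) = twist ((-1) ^+ #|P| *: c P).
  by rewrite rconv_conj_mono wP linearZ.
move/(rconv_twistX EnE rhoA r wP' wP); rewrite mono_x x_mono.
rewrite (@sign_eq _ (#|P|.+2 + #|P|) 0); last by parity.
rewrite scale1r -scalerAr => e; rewrite [RHS]linearZ /= -e.
by rewrite -mulr2n -scaler_nat scalerA mulVf // scale1r.
Qed.

Lemma rconv_odd P : w (g ^+ #|P|.+1 * 'x_P) = twist (c P).
Proof.
elim/set_max_ind: P => [|P r Pr IH].
  by rewrite /c cards0 xprod0 mulr1 expr1.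
have := rconv_step Pr IH; rewrite /c cardsU1 above_notin // xprodU1 // add1n => ->.
by rewrite (twistK EnE mb rhoA).
Qed.

Lemma phi_step P r : above P r ->
  phi (g ^+ #|P| * ('x_P * x r)) = 2^-1 *: (c P * X r - (-1) ^+ #|P| *: (X r * c P)).
Proof.
move=> Pr; have := rconv_step Pr (rconv_odd P).
have -> : g ^+ #|P|.+2 = g ^+ #|P| by apply: (En_gexp EnE); parity.
by move=> ->; rewrite (twistK EnE mb rhoA).
Qed.

Lemma cU1 P r : above P r ->
  c (r |: P) = 2^-1 *: (c P * X r - (-1) ^+ #|P| *: (X r * c P)).
Proof.
move=> Pr; rewrite -phi_step // /c cardsU1 above_notin // xprodU1 // add1n.
by congr (phi (_ * _)); apply: (En_gexp EnE); parity.
Qed.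

(* For r below the largest element m of P, exchange x_m and x_r and expand in *)
(* the opposite order.                                                         *)
Lemma phi_odd P r :
  phi (g ^+ #|P| * ('x_P * x r)) = 2^-1 *: (c P * X r - (-1) ^+ #|P| *: (X r * c P)).
Proof.
elim/set_max_ind: P r => [|P m Pm IH] r; first by apply: phi_step => j; rewrite inE.
have [rm|mr|/val_inj ->] := ltngtP r m.
- have -> : phi (g ^+ #|m |: P| * ('x_(m |: P) * x r)) =
      - (2^-1 *: (phi (g ^+ #|P| * ('x_P * x r)) * X m
                  - (-1) ^+ #|P|.+1 *: (X m * phi (g ^+ #|P| * ('x_P * x r))))).
    rewrite xprodU1 // -mulrA (En_xC EnE) mulrN mulrA mulrN !linearN; congr (- _).
    rewrite cardsU1 above_notin // add1n [_ * x r]En_xprodMx.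
    (* For r in P both sides vanish, since x_P x_r = 0. *)
    case: (boolP (r \in P)) => rP /=.
      by rewrite mulr0 !scale0r mul0r !mulr0 !linear0 mul0r mulr0 scaler0 subr0 scaler0.
    have rPm : above (r |: P) m by move=> j /setU1P[->|/Pm].
    rewrite mulr1 -!scalerAl -!scalerAr !linearZ /=.
    have := phi_step rPm; rewrite cardsU1 rP add1n => ->.
    have -> : phi (g ^+ #|P| * 'x_(r |: P)) = c (r |: P).
      by rewrite /c cardsU1 rP; congr (phi (_ * _)); apply: (En_gexp EnE); parity.
    by rewrite -scalerAl -!scalerAr; abel.
  (* Both sides are now iterated half supercommutators of c P with X_r and X_m, taken in the two
     orders. *)
  rewrite IH cU1 // cardsU1 above_notin // add1n exprS mulN1r !scaleNr !opprK.
  apply: half_supercomm_swap; first by rewrite -expr2 sqrr_sign.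
  by apply: (cl_XXl rel); rewrite -val_eqE ltn_eqF.
- apply: phi_step => j /setU1P[->//|/Pm jm]; apply: ltn_trans jm mr.
(* For r = m the left side is 0 by x_m^2 = 0, and the right side because X_m^2 is scalar. *)
rewrite cU1 // xprodU1 // -[_ * x m * x m]mulrA (En_xx EnE) !mulr0 !linear0.
rewrite cardsU1 above_notin // add1n exprS mulN1r !scaleNr opprK.
by symmetry; apply: half_supercomm_sqr (cl_XX rel m); rewrite -expr2 sqrr_sign.
Qed.

(** c P arises from phi(g) by iterated half supercommutators with the X_r, and G X_r + X_r G is
    scalar. *)
Lemma c_commG P : G * phi g = phi g * G -> (-1) ^+ #|P| *: (G * c P) = c P * G.
Proof.
move=> Gg; elim/set_max_ind: P => [|P r Pr IH].
  by rewrite cards0 scale1r /c cards0 xprod0 mulr1 expr1.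
rewrite cU1 // cardsU1 above_notin // add1n exprS mulN1r.
by apply: (half_supercomm_comm _ (cl_GX rel r) IH); rewrite -expr2 sqrr_sign.
Qed.

(** The equations on w and phi are linear in h. Even monomials are covered by the hypothesis, odd
    ones by [rconv_odd], [c_commG] and [phi_odd]. *)
Lemma is_integral_of_conditions : G * phi g = phi g * G ->
  (forall P, exists a, [/\ w (g ^+ #|P| * 'x_P) = twist a,
    (-1) ^+ #|P| *: (G * a) = a * G & forall i, (-1) ^+ #|P| *: (X i * a) = a * X i]) ->
  is_integral T.
Proof.
move=> Gg even.
have phiE P a : w (g ^+ #|P| * 'x_P) = twist a -> phi (g ^+ #|P| * 'x_P) = a.
  by move=> ->; rewrite (twistK EnE mb rhoA).
have I1 h : w h = twist (phi h).
  apply: (En_ext (f := w) (f' := fun h => twist (phi h))) => [k u v|k u v|P|P].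
  - exact: linearP.
  - by rewrite !linearP.
  - by have [a [e _ _]] := even P; rewrite (phiE _ _ e).
  exact: rconv_odd.
apply/(is_integralP EnE mb rhoA); split=> // [|i].
  apply/(integralG EnE mb rhoA I1) => h.
  apply: (En_ext (f := fun h => G * phi (g * h * g)) (f' := fun h => phi h * G))
    => [k u v|k u v|P|P].
  - by rewrite mulPr mulPl !linearP mulPr.
  - by rewrite !linearP mulPl.
  - have [a [e aG _]] := even P.
    by rewrite conj_mono !linearZ /= (phiE _ _ e) -scalerAr aG.
  by rewrite conj_mono !linearZ /= -scalerAr -c_commG.
apply/(integralX EnE mb rhoA I1) => h.
apply: (En_ext (f := fun h => phi (g * h * x i) + phi (x i * g * h))
  (f' := fun h => phi h * X i - X i * phi (g * h * g))) => [||P|P].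
- by apply: linear_add => k u v; rewrite ?mulPr ?mulPl !linearP.
- apply: linear_add => k u v; first by rewrite !linearP mulPl.
  by rewrite mulPr mulPl !linearP mulPr opprD scalerN.
- have [a [e _ aX]] := even P.
  rewrite conj_mono mono_x x_mono !linearZ /= (phiE _ _ e) -scalerAr aX subrr.
  rewrite (@sign_eq _ (#|P|.+1 + #|P|) 1); last by parity.
  by rewrite expr1 scaleN1r subrr.
rewrite conj_mono mono_x x_mono !linearZ /= -scalerAr.
rewrite (@sign_eq _ (#|P|.+2 + #|P|) 0); last by parity.
have -> : g ^+ #|P|.+2 = g ^+ #|P| by apply: (En_gexp EnE); parity.
rewrite scale1r phi_odd -mulr2n -scaler_nat scalerA divff // scale1r.
by [].
Qed.

End Sufficiency.

Lemma conditions_of_is_integral : is_integral T ->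
  [/\ condition1 g x alpha gamma G X T, condition2 g x X T
    & condition3 g x alpha beta gamma lambda G X T].
Proof.
case/(is_integralP EnE mb rhoA) => I1 IG IX.
have phiG := (integralG EnE mb rhoA I1).1 IG.
have phiX i := (integralX EnE mb rhoA I1 i).1 (IX i).
split.
- apply/(condition1P EnE ClA rhoA); exists (phi g); split; first exact: I1.
  by rewrite -phiG (En_gg EnE) mul1r.
- by apply/condition2P => P r _; apply: IX.
apply/(condition3P EnE ClA rhoA) => P; exists (phi (g ^+ #|P| * 'x_P)); split=> [||i].
- exact: I1.
- by rewrite -phiG conj_mono !linearZ /= scalerAr.
have := phiX i (g ^+ #|P| * 'x_P).
rewrite conj_mono mono_x x_mono !linearZ /= (@sign_eq _ (#|P|.+1 + #|P|) 1); last by parity.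
by rewrite expr1 scaleN1r subrr -scalerAr => /esym/eqP; rewrite subr_eq0 => /eqP.
Qed.

End Main.

Theorem theorem4p11 (K : fieldType) (charK : 2%N \notin [pchar K])
    (n : nat) (n_ge1 : (1 <= n)%N)
    (E : hopf_algebra K) (g : E) (x : 'I_n -> E) (EnE : is_En g x)
    (alpha : K) (beta gamma : 'I_n -> K) (lambda : 'I_n -> 'I_n -> K)
    (A : comodule_algebra E) (G : A) (X : 'I_n -> A)
    (ClA : is_clifford alpha beta gamma lambda G X)
    (rhoA : canonical_coaction g x G X)
    (T : {linear E -> tens A E}) :
  is_integral T <->
  [/\ condition1 g x alpha gamma G X T,
      condition2 g x X T
    & condition3 g x alpha beta gamma lambda G X T].
Proof.
have two_neq0 : (2 : K) != 0 by move: charK; rewrite inE.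
split=> [|[C1 C2 C3]]; first exact: conditions_of_is_integral.
have [a [wg aG]] := (condition1P EnE ClA rhoA T).1 C1.
have phig : counit_r (rconv T g) = a by rewrite wg (twistK EnE (clifford_basis ClA) rhoA).
apply: (is_integral_of_conditions EnE ClA rhoA two_neq0).
- by rewrite phig.
- exact/(condition2P EnE X T two_neq0).
- by rewrite phig.
exact/(condition3P EnE ClA rhoA T).
Qed.
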